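(* For every constant $c>0$ there is a constant $C>0$ such that the following holds. Let $G$ be a connected weighted undirected graph with $n\ge 2$ vertices and positive edge weights, let $\epsilon>0$, and let $t=\lceil C\epsilon^{-2}\log^2 n\rceil$. Let $T_1,\ldots,T_t$ be $t$ independent inverse leverage score weighted random spanning trees of $G$. Then with probability at least $1-n^{-c}$, $$(1-\epsilon)L_G\preceq \frac1t\sum_{i=1}^t L_{T_i}\preceq (1+\epsilon)L_G .$$
   Context: Let $G=(V,E,w)$ be a connected undirected graph with weights $w_e>0$. For an edge $e=(u,v)$ let $b_e\in\mathbb{R}^V$ have entry $1$ at $u$, $-1$ at $v$, and $0$ elsewhere. The Laplacian is $L_G=\sum_{e\in E}w_e b_eb_e^\top$, and $L_G^\dagger$ is its Moore-Penrose pseudoinverse. The leverage score of $e$ is $l_e=w_e\, b_e^\top L_G^\dagger b_e$. A random spanning tree $T$ of $G$ is sampled from the $w$-uniform distribution, in which the probability of a spanning tree $T$ is proportional to $\prod_{e\in T}w_e$. An inverse leverage score weighted random spanning tree is such a tree in which each edge $e\in T$ is given weight $w_e/l_e$, where $l_e$ is the leverage score of $e$ in $G$; thus its Laplacian is $L_T=\sum_{e\in T}\frac{w_e}{l_e}b_eb_e^\top$. $A\preceq B$ means that $B-A$ is positive semidefinite. *)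

(* Defs.v *)
From HB Require Import structures.
From mathcomp Require Import all_boot all_order all_algebra.
From mathcomp Require Import all_classical all_reals all_analysis.

Set Implicit Arguments.
Unset Strict Implicit.
Unset Printing Implicit Defensive.

Import Order.TTheory GRing.Theory Num.Theory.

Local Open Scope classical_set_scope.
Local Open Scope ring_scope.

Definition psd (R : realType) (n : nat) (M : 'M[R]_n) : Prop :=
  M^T = M /\ forall x : 'cV[R]_n, 0 <= (x^T *m M *m x) 0 0.

Definition loewner_le (R : realType) (n : nat) (A B : 'M[R]_n) : Prop :=
  psd (B - A).

Definition is_mp_pinv (R : realType) (n : nat) (A X : 'M[R]_n) : Prop :=
  [/\ A *m X *m A = A, X *m A *m X = X,
      (A *m X)^T = A *m X & (X *m A)^T = X *m A].

(* The default value 0 is never used, see mp_pinvP and mp_pinv_unique. *)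
Definition mp_pinv (R : realType) (n : nat) (A : 'M[R]_n) : 'M[R]_n :=
  xget 0 [set X | is_mp_pinv A X].

Lemma row_free_gram_unit (R : realType) (m n : nat) (A : 'M[R]_(m, n)) :
  row_free A -> A *m A^T \in unitmx.
Proof.
move=> freeA; rewrite -row_free_unit -kermx_eq0; apply/rowV0P => v.
move=> /sub_kermxP; rewrite mulmxA => vAA0.
have : (v *m A) *m (v *m A)^T = 0 by rewrite trmx_mul mulmxA vAA0 mul0mx.
move=> /matrixP /(_ 0 0); rewrite !mxE.
under eq_bigr do rewrite [_^T _ _]mxE -expr2.
move/eqP; rewrite psumr_eq0; last by move=> *; exact: sqr_ge0.
move=> /allP vA0; apply: (row_free_inj freeA); rewrite mul0mx.
apply/rowP => j; rewrite [RHS]mxE.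
by have /= := vA0 j (mem_index_enum _); rewrite sqrf_eq0 => /eqP.
Qed.

Lemma mp_pinvP (R : realType) (n : nat) (A : 'M[R]_n) :
  is_mp_pinv A (mp_pinv A).
Proof.
apply: (xgetPex 0 (P := [set X | is_mp_pinv A X])).
have uC : (col_base A)^T *m col_base A \in unitmx.
  rewrite -{2}[col_base A]trmxK; apply: row_free_gram_unit.
  by rewrite /row_free mxrank_tr -/(row_full _) col_base_full.
have uD := row_free_gram_unit (row_base_free A).
have := mulmx_base A; move: (col_base A) (row_base A) uC uD.
move: (\rank A) => r C D uC uD AE.
pose X := D^T *m invmx (D *m D^T) *m (invmx (C^T *m C) *m C^T).
have AX : A *m X = C *m invmx (C^T *m C) *m C^T.
  by rewrite -AE /X -!mulmxA (mulmxA D D^T) mulKVmx.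
have XA : X *m A = D^T *m invmx (D *m D^T) *m D.
  by rewrite -AE /X -!mulmxA (mulmxA C^T C) mulKmx.
exists X; split.
- by rewrite AX -AE -!mulmxA (mulmxA C^T C) mulKmx.
- by rewrite XA /X -!mulmxA (mulmxA D D^T) mulKVmx.
- by rewrite AX !trmx_mul trmxK trmx_inv trmx_mul trmxK mulmxA.
- by rewrite XA !trmx_mul trmxK trmx_inv trmx_mul trmxK mulmxA.
Qed.

Lemma mp_pinv_unique (R : realType) (n : nat) (A X : 'M[R]_n) :
  is_mp_pinv A X -> mp_pinv A = X.
Proof.
suff uniq_pinv (Y Z : 'M[R]_n) : is_mp_pinv A Y -> is_mp_pinv A Z -> Y = Z.
  by move=> AX; apply: uniq_pinv => //; exact: mp_pinvP.
move=> [AYA YAY AYt YAt] [AZA ZAZ AZt ZAt].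
have AYZ : A *m Y = A *m Z.
  have AZAY : A *m Z *m (A *m Y) = A *m Y by rewrite mulmxA AZA.
  by rewrite -AYt -AZAY trmx_mul AYt AZt mulmxA AYA.
have YZA : Y *m A = Z *m A.
  have ZAYA : Z *m A *m (Y *m A) = Z *m A by rewrite -!mulmxA (mulmxA A) AYA.
  by rewrite -ZAt -ZAYA trmx_mul YAt ZAt -!mulmxA (mulmxA A) AZA.
by rewrite -YAY YZA -mulmxA AYZ mulmxA ZAZ.
Qed.

(* Parallel edges are allowed.  The orientation (src, dst) of an edge is
   arbitrary; it only fixes the sign of the incidence vector below. *)
Record wgraph (R : realType) (n : nat) := WGraph {
  edge : finType;
  src : edge -> 'I_n;
  dst : edge -> 'I_n;
  weight : edge -> R;
  src_neq_dst : forall e, src e != dst e;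
  weight_gt0 : forall e, 0 < weight e }.

Section Graph.
Context {R : realType} {n : nat} (G : wgraph R n).
Implicit Types (e : edge G) (S : {set edge G}).

Definition adjacent S : rel 'I_n := fun u v =>
  [exists e in S, ((src e == u) && (dst e == v))
               || ((src e == v) && (dst e == u))].

Definition spans_connected S : bool :=
  [forall u, forall v, connect (adjacent S) u v].

Definition graph_connected : bool := spans_connected [set: edge G].

(* A dart (e, false) traverses e from src to dst, (e, true) from dst to src. *)
Definition dart_tail (a : edge G * bool) := if a.2 then dst a.1 else src a.1.
Definition dart_head (a : edge G * bool) := if a.2 then src a.1 else dst a.1.

(* Edges are required to be distinct so that e followed by its reverse is
   not a cycle, while two parallel edges do form one. *)
Definition is_cycle (s : seq (edge G * bool)) : bool :=
  [&& s != [::], cycle (fun a b => dart_head a == dart_tail b) s,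
      uniq [seq dart_tail a | a <- s] & uniq [seq a.1 | a <- s]].

Definition acyclic S : Prop :=
  ~ exists s, is_cycle s /\ {in s, forall a, a.1 \in S}.

Definition spanning_tree S : bool := spans_connected S && `[< acyclic S >].

Definition incidence e : 'cV[R]_n :=
  \col_v ((v == src e)%:R - (v == dst e)%:R).

Definition laplacian : 'M[R]_n :=
  \sum_(e : edge G) weight e *: (incidence e *m (incidence e)^T).

Definition leverage e : R :=
  weight e * ((incidence e)^T *m mp_pinv laplacian *m incidence e) 0 0.

Definition tree_laplacian S : 'M[R]_n :=
  \sum_(e in S) (weight e / leverage e) *: (incidence e *m (incidence e)^T).

Definition tree_prob S : R :=
  if spanning_tree S then
    (\prod_(e in S) weight e) /
    (\sum_(S' : {set edge G} | spanning_tree S') \prod_(e in S') weight e)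
  else 0.

End Graph.

Section Probability.
Context {d : measure_display} {Omega : measurableType d} {R : realType}.
Variable P : probability Omega R.

(* Random variables with values in a finite type, whose subsets are all
   regarded as measurable. *)
Definition finite_rv (A : finType) (X : Omega -> A) : Prop :=
  forall B : set A, measurable (X @^-1` B).

Definition mutually_independent (A : finType) (t : nat)
    (X : 'I_t -> Omega -> A) : Prop :=
  forall (J : {set 'I_t}) (B : 'I_t -> set A),
    P (\bigcap_(i in [set` J]) (X i @^-1` B i)) =
    (\prod_(i in J) P (X i @^-1` B i))%E.

Definition random_spanning_tree (n : nat) (G : wgraph R n)
    (T : Omega -> {set edge G}) : Prop :=
  finite_rv T /\
  forall S : {set edge G}, P (T @^-1` [set S]) = (tree_prob S)%:E.

End Probability.

(* Main.v *)
(** In the edge space, with S^T S = L_G, a tree T becomes M_T = \sum_(e in T) A_e,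
   where A_e is the rank-one projection onto S L_G^+ b_e, and E M_T is the
   projection Pi = S L_G^+ S^T; one has to bound M_(T_1) + ... + M_(T_t) - t Pi.
   Reveal the edges of a tree one at a time, in uniformly random order.  The
   conditional means of M_T form a martingale.  Because spanning trees are
   negatively correlated, the increment caused by an edge e is A_e - D with
   0 <= D <= 1, and when j edges remain its conditional second moment is at
   most (4 / j) Pi; summing over j gives the factor log n.  By the
   Golden-Thompson inequality each increment multiplies the expectation of
   tr (Pi exp (theta M)) by at most 1 + O(theta^2 / j), so t trees give at most
   n exp (O(theta^2 t log n)), and Markov's inequality concludes.

   The matrix exponential is replaced by (1 + H / N)^N with N a power of two,
   for which Golden-Thompson holds up to an error O(1 / N).

   P(e in T) = l_e (Kirchhoff) comes from averaging over trees the expansion of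
   b_e in the basis given by the tree.  Negative correlation then follows from
   the monotonicity of effective resistances in the edge weights; conditioning
   on an edge is the limit of an infinite weight. *)

Require Import Defs.
From HB Require Import structures.
From mathcomp Require Import all_boot all_order all_algebra.
From mathcomp Require Import all_classical all_reals all_analysis.
From mathcomp Require Import ring lra.

Set Implicit Arguments.
Unset Strict Implicit.
Unset Printing Implicit Defensive.

Import Order.TTheory GRing.Theory Num.Theory.

Local Open Scope classical_set_scope.
Local Open Scope ring_scope.

(** * Trace inequalities *)

Section TraceInequalities.
Context {R : realType} {n : nat}.
Implicit Types A B C D X : 'M[R]_n.

Lemma mxtrace_exprC A B m : \tr ((A * B) ^+ m) = \tr ((B * A) ^+ m).
Proof.
case: m => // m.
have -> : (A * B) ^+ m.+1 = A * ((B * A) ^+ m * B).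
  elim: m => [|m IH]; first by rewrite expr0 mul1r expr1.
  by rewrite exprS IH exprS !mulrA.
by rewrite -mulmxE mxtrace_mulC mulmxE -mulrA -exprSr.
Qed.

Lemma trmx_expr A m : (A ^+ m)^T = A^T ^+ m.
Proof.
elim: m => [|m IH]; first by rewrite !expr0 trmx1.
by rewrite exprS -mulmxE trmx_mul IH mulmxE -exprSr.
Qed.

Lemma mxtrace_mul_tr_ge0 (m p : nat) (A : 'M[R]_(m, p)) : 0 <= \tr (A^T *m A).
Proof.
apply: sumr_ge0 => i _; rewrite mxE; apply: sumr_ge0 => j _.
by rewrite mxE -expr2 sqr_ge0.
Qed.

Lemma mxtrace_mulmx_le A B : \tr (A *m B) *+ 2 <= \tr (A^T *m A) + \tr (B *m B^T).
Proof.
have := mxtrace_mul_tr_ge0 (A - B^T).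
rewrite [(A - _)^T]raddfB /= trmxK mulmxBl !mulmxBr !raddfB /= -trmx_mul mxtrace_tr.
rewrite [\tr (B *m A)]mxtrace_mulC; lra.
Qed.

(* The two inequalities feed each other: the second at j.+1 is the second at j
   for X ^+ 2, followed by the first at j for X^T X and X X^T, whose powers have
   equal traces. *)
Lemma mxtrace_mul_expr_le_pow2 j :
  (forall C D, C^T = C -> D^T = D ->
     \tr ((C * D) ^+ (2 ^ j)) <= \tr (C ^+ (2 ^ j) * D ^+ (2 ^ j))) /\
  (forall X, \tr (X ^+ (2 ^ j.+1)) <= \tr ((X^T * X) ^+ (2 ^ j))).
Proof.
elim: j => [|j [IHP IHQ]].
  split=> [C D _ _|X]; first by rewrite !expr1.
  have := mxtrace_mulmx_le X X; rewrite expn1 expn0 expr1 expr2 -!mulmxE.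
  rewrite [\tr (X *m X^T)]mxtrace_mulC; lra.
split=> [C D Cs Ds|X].
  (* The second inequality applied to [C * D] produces [D C C D], and cyclicity of the trace of
     powers turns it into [C ^+ 2 * D ^+ 2]. *)
  apply: le_trans (IHQ _) _.
  rewrite -!mulmxE trmx_mul Cs Ds !mulmxE -mulrA mxtrace_exprC.
  rewrite !expnS !exprM [C * (C * D) * D](_ : _ = C ^+ 2 * D ^+ 2).
    by apply: IHP; rewrite trmx_expr ?Cs ?Ds.
  by rewrite !expr2 !mulrA.
rewrite expnS exprM; apply: le_trans (IHQ _) _.
rewrite expr2 -!mulmxE trmx_mul !mulmxE -mulrA mxtrace_exprC.
rewrite mulrA -mulrA.
set C := X^T * X; set D := X * X^T.
have Cs : C^T = C by rewrite /C -mulmxE trmx_mul trmxK.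
have Ds : D^T = D by rewrite /D -mulmxE trmx_mul trmxK.
apply: le_trans (IHP _ _ Cs Ds) _.
have := mxtrace_mulmx_le (C ^+ (2 ^ j)) (D ^+ (2 ^ j)).
rewrite !trmx_expr Cs Ds !mulmxE -!exprD !addnn -!mul2n -!expnS.
have -> : \tr (D ^+ (2 ^ j.+1)) = \tr (C ^+ (2 ^ j.+1)) by exact: mxtrace_exprC.
lra.
Qed.

End TraceInequalities.

(** * Positive semidefinite matrices and polynomial bounds in the Loewner order *)

Section PositiveSemidefinite.
Context {R : realType}.

Lemma psd0 n : psd (0 : 'M[R]_n).
Proof. by split=> [|x]; rewrite ?trmx0 // mulmx0 mul0mx mxE. Qed.

Lemma psdD n (A B : 'M[R]_n) : psd A -> psd B -> psd (A + B).
Proof.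
move=> [As A0] [Bs B0]; split=> [|x]; first by rewrite raddfD /= As Bs.
by rewrite mulmxDr mulmxDl mxE addr_ge0.
Qed.

Lemma psdZ n a (A : 'M[R]_n) : 0 <= a -> psd A -> psd (a *: A).
Proof.
move=> a0 [As A0]; split=> [|x]; first by rewrite linearZ /= As.
by rewrite -scalemxAr -scalemxAl mxE mulr_ge0.
Qed.

Lemma psd_sum n (I : finType) (P : pred I) (F : I -> 'M[R]_n) :
  (forall i, P i -> psd (F i)) -> psd (\sum_(i | P i) F i).
Proof. by move=> F0; apply: big_ind => //; [exact: psd0|exact: psdD]. Qed.

Lemma psd_conj m n (A : 'M[R]_m) (B : 'M[R]_(m, n)) :
  psd A -> psd (B^T *m A *m B).
Proof.
move=> [As A0]; split=> [|x]; first by rewrite !trmx_mul trmxK As mulmxA.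
by have := A0 (B *m x); rewrite trmx_mul !mulmxA.
Qed.

Lemma psd1 n : psd (1 : 'M[R]_n).
Proof.
split=> [|x]; first by rewrite trmx1.
have -> : (1 : 'M[R]_n) = 1%:M by [].
rewrite mulmx1 mxE; apply: sumr_ge0 => i _.
by rewrite mxE -expr2 sqr_ge0.
Qed.

Lemma psd_gram m n (B : 'M[R]_(m, n)) : psd (B^T *m B).
Proof. by have := psd_conj B (psd1 m); rewrite mulmx1. Qed.

Lemma psd_conj_sym n (A B : 'M[R]_n) : B^T = B -> psd A -> psd (B * A * B).
Proof. by move=> Bs /(psd_conj B); rewrite Bs. Qed.

Lemma psd_sqr n (A : 'M[R]_n) : A^T = A -> psd (A ^+ 2).
Proof. by move=> As; have := psd_gram A; rewrite As. Qed.

Lemma psd_trace_ge0 n (A : 'M[R]_n) : psd A -> 0 <= \tr A.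
Proof.
move=> [_ A0]; apply: sumr_ge0 => i _.
have := A0 (delta_mx i 0).
by rewrite trmx_delta -rowE -colE !mxE.
Qed.

(** By cyclicity this is the trace of the conjugate [B * A * B]. It makes the trace against an even
    power monotone in the Loewner order. *)
Lemma psd_trace_sqr_mul_ge0 n (A B : 'M[R]_n) :
  B^T = B -> psd A -> 0 <= \tr (B ^+ 2 * A).
Proof.
move=> Bs /(psd_conj_sym Bs)/psd_trace_ge0.
suff -> : \tr (B ^+ 2 * A) = \tr (B * A * B) by [].
by rewrite expr2 -mulrA; exact: mxtrace_mulC.
Qed.

(** An algebraic identity replaces diagonalisation: the difference is a sum of two conjugates of psd
    matrices by symmetric ones. *)
Lemma psd_sub_sqr n (D : 'M[R]_n) : psd D -> psd (1 - D) -> psd (D - D ^+ 2).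
Proof.
move=> D0 D1.
have [Ds _] := D0; have [Es _] := D1.
suff -> : D - D ^+ 2 = D * (1 - D) * D + (1 - D) * D * (1 - D).
  by apply: psdD; exact: psd_conj_sym.
rewrite !(mulrBl, mulrBr, mul1r, mulr1) -!mulrA expr2.
move: (D * D) (D * (D * D)) => D2 D3.
by apply/matrixP => i j; rewrite !mxE; ring.
Qed.

Lemma psd_sub_sqr1 n (X : 'M[R]_n) :
  psd (1 - X) -> psd (1 + X) -> psd (1 - X ^+ 2).
Proof.
move=> D0 D1.
have [Ds _] := D0; have [Es _] := D1.
suff -> : 1 - X ^+ 2 = 2^-1 *: ((1 + X) * (1 - X) * (1 + X) +
                                (1 - X) * (1 + X) * (1 - X)).
  by apply: psdZ => //; apply: psdD; exact: psd_conj_sym.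
rewrite !(mulrBl, mulrBr, mulrDr, mulrDl, mul1r, mulr1) -!mulrA expr2.
move: (X * X) (X * (X * X)) => D2 D3.
by move: (1 : 'M[R]_n) => Id; apply/matrixP => i j; rewrite !mxE; field.
Qed.

(** Induction in steps of two, since conjugating [1 - X ^+ i] by [X] raises the degree by two. *)
Lemma psd_sub_expr n (X : 'M[R]_n) i :
  psd (1 - X) -> psd (1 + X) -> psd (1 - X ^+ i).
Proof.
move=> D0 D1; have Xs : X^T = X.
  have [+ _] := D1; rewrite raddfD /= trmx1; exact: addrI.
elim/ltn_ind: i => -[|[|i]] IH; first by rewrite expr0 subrr; exact: psd0.
- by rewrite expr1.
- have -> : 1 - X ^+ i.+2 = (1 - X ^+ 2) + X * (1 - X ^+ i) * X.
    by rewrite mulrBr mulrBl mulr1 -expr2 -exprS -exprSr addrA subrK.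
  apply: psdD; first exact: psd_sub_sqr1.
  by apply: psd_conj_sym => //; exact: IH.
Qed.

Lemma scalemxMl n a (A B : 'M[R]_n) : a *: A * B = a *: (A * B).
Proof. by have := scalemxAl a A B. Qed.

Lemma scalemxMr n a (A B : 'M[R]_n) : A * (a *: B) = a *: (A * B).
Proof. by have := scalemxAr a A B. Qed.

Lemma scalemx_expr n a (A : 'M[R]_n) i : (a *: A) ^+ i = a ^+ i *: A ^+ i.
Proof.
elim: i => [|i IH]; first by rewrite !expr0 scale1r.
by rewrite !exprS IH scalemxMl scalemxMr scalerA.
Qed.

(** The left side is at most e, and e is at most 4 because exp(-1/2) is at least 1 - 1/2. *)
Lemma compound_interest_le4 N : (1 + N.+1%:R^-1) ^+ N.+1 <= 4 :> R.
Proof.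
have N0 : 0 < N.+1%:R :> R by [].
have : (1 + N.+1%:R^-1) ^+ N.+1 <= expR 1 :> R.
  rewrite -[X in expR X](@mulVf _ N.+1%:R) // expRM_natr.
  by rewrite lerXn2r ?nnegrE ?addr_ge0 ?expR_ge0 ?invr_ge0 // expR_ge1Dx.
move=> /le_trans; apply.
have h : 2^-1 <= expR (- 2^-1) :> R by have := @expR_ge1Dx R (- 2^-1); lra.
have e1 : 1 = - (- 2^-1 * 2) :> R by rewrite mulNr opprK mulVf.
rewrite [X in expR X]e1 expRN expRM_natr -[4]invrK lef_pV2 ?posrE ?exprn_gt0 ?expR_gt0 //.
by apply: le_trans (_ : 2^-1 ^+ 2 <= _); [lra|rewrite lerXn2r ?nnegrE ?expR_ge0].
Qed.

(** In the binomial expansion the terms of degree at least 2 are [X * (sum of c i *: X ^+ i) * X]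
    with [c i >= 0]. Each [X ^+ i] is at most 1, and the [c i] sum to at most 4 - 1 - 1 = 2. *)
Lemma psd_expr_quadratic_bound n (X : 'M[R]_n) N :
  psd (1 - X) -> psd (1 + X) ->
  psd (1 + X + 2 *: X ^+ 2 - (1 + N.+1%:R^-1 *: X) ^+ N.+1).
Proof.
move=> D0 D1; have Xs : X^T = X.
  have [+ _] := D1; rewrite raddfD /= trmx1; exact: addrI.
case: N => [|N].
  rewrite expr1 invr1 scale1r addrAC subrr add0r.
  by apply: psdZ => //; exact: psd_sqr.
set a : R := N.+2%:R^-1.
have a0 : 0 <= a by rewrite invr_ge0.
pose c i : R := 'C(N.+2, i.+2)%:R * a ^+ i.+2.
have c0 i : 0 <= c i by rewrite mulr_ge0 ?exprn_ge0.
have Na : N.+2%:R * a = 1 by rewrite mulfV.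
have sumc : \sum_(i < N.+1) c i <= 2.
  have := compound_interest_le4 N.+1; rewrite -/a exprDn.
  rewrite 2!big_ord_recl !(bin0, bin1, expr1n, expr0, expr1, mulr1, mul1r).
  under eq_bigr do rewrite expr1n mul1r -mulr_natl.
  rewrite -[a *+ _]mulr_natl Na /c; lra.
have -> : (1 + a *: X) ^+ N.+2 =
    1 + X + X * (\sum_(i < N.+1) c i *: X ^+ i) * X.
  rewrite exprDn_comm; last exact/commr_sym/commr1.
  rewrite 2!big_ord_recl !(bin0, bin1, expr1n, expr0, expr1, mul1r).
  rewrite mulr1n -scaler_nat scalerA Na scale1r addrA; congr (_ + _).
  rewrite mulr_sumr mulr_suml; apply: eq_bigr => i _.
  rewrite expr1n mul1r -scaler_nat scalemx_expr scalerA.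
  by rewrite scalemxMr scalemxMl -exprS -exprSr.
have -> : 1 + X + 2 *: X ^+ 2 - (1 + X + X * (\sum_(i < N.+1) c i *: X ^+ i) * X)
   = X * ((\sum_(i < N.+1) c i *: (1 - X ^+ i)) +
          (2 - \sum_(i < N.+1) c i) *: (1 : 'M[R]_n)) * X.
  rewrite opprD addrACA subrr add0r.
  under [in RHS]eq_bigr do rewrite scalerBr.
  rewrite sumrB -scaler_suml scalerBl [_ - _ + _]addrC addrA subrK.
  by rewrite mulrBr mulrBl scalemxMr scalemxMl mulr1 expr2.
apply: psd_conj_sym => //; apply: psdD.
  by apply: psd_sum => i _; apply: psdZ => //; exact: psd_sub_expr.
by apply: psdZ; [lra|exact: psd1].
Qed.

Lemma dot_combination_ge0 n (u v : 'cV[R]_n) a b :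
  0 <= a ^+ 2 * (u^T *m u) 0 0 - a * b * (u^T *m v) 0 0 *+ 2
       + b ^+ 2 * (v^T *m v) 0 0.
Proof.
have dotE (x y : 'cV[R]_n) : (x^T *m y) 0 0 = \sum_i x i 0 * y i 0.
  by rewrite mxE; apply: eq_bigr => i _; rewrite mxE.
rewrite !dotE !mulr_sumr -sumrMnl -sumrB -big_split /=.
apply: sumr_ge0 => i _; apply: le_trans (sqr_ge0 (a * u i 0 - b * v i 0)) _.
lra.
Qed.

Lemma dot_ge0 n (x : 'cV[R]_n) : 0 <= (x^T *m x) 0 0.
Proof. by have := dot_combination_ge0 x x 1 0; lra. Qed.

(** A Jensen inequality for the spectral measure of [y], obtained by repeated squaring. Each
    squaring is the Cauchy-Schwarz inequality for [y] and [A *m y]. *)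
Lemma qf_expr_pow2_ge n (A : 'M[R]_n) (y : 'cV[R]_n) r j :
  A^T = A -> 0 <= r -> r * (y^T *m y) 0 0 <= (y^T *m A *m y) 0 0 ->
  r ^+ (2 ^ j) * (y^T *m y) 0 0 <= (y^T *m A ^+ (2 ^ j) *m y) 0 0.
Proof.
elim: j A r => [|j IH] A r As r0 rA; first by rewrite expn0 !expr1.
rewrite expnS !exprM; apply: IH; rewrite ?exprn_ge0 //.
  by rewrite trmx_expr As.
have -> : y^T *m A ^+ 2 *m y = (A *m y)^T *m (A *m y).
  by rewrite trmx_mul As expr2 !mulmxA.
have h := dot_combination_ge0 y (A *m y).
move: rA h (dot_ge0 y) (dot_ge0 (A *m y)); rewrite -mulmxA.
move: ((y^T *m y) 0 0) ((y^T *m (A *m y)) 0 0) (((A *m y)^T *m (A *m y)) 0 0).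
move=> s q w rA h s0 w0.
have [sp|] := ltrP 0 s; last first.
  by move=> sle; have -> : s = 0; [apply/eqP; rewrite eq_le sle s0|rewrite mulr0].
have qq : (r * s) * (r * s) <= q * q by apply: ler_pM => //; exact: mulr_ge0.
rewrite -(ler_pM2l sp).
have : s * (s * w - q ^+ 2) >= 0 by have := h q s; lra.
rewrite pmulr_rge0 //; lra.
Qed.

End PositiveSemidefinite.

(** * The trace exponential *)

Section RowSumBound.
Context {R : realType} {n : nat}.
Implicit Types A B : 'M[R]_n.

(** The operator norm for the sup norm: submultiplicative and read off from the entries. It controls
    the Lie-Trotter error. *)
Definition row_sum_le (c : R) A := forall i, \sum_j `|A i j| <= c.

Lemma row_sum_le_weak c d A : c <= d -> row_sum_le c A -> row_sum_le d A.
Proof. by move=> cd Ac i; exact: le_trans (Ac i) cd. Qed.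

Lemma row_sum_le_exists A : exists2 c : R, 0 <= c & row_sum_le c A.
Proof.
exists (\sum_i \sum_j `|A i j|).
  by apply: sumr_ge0 => i _; apply: sumr_ge0.
move=> i; rewrite [leRHS](bigD1 i) //= lerDl.
by apply: sumr_ge0 => k _; apply: sumr_ge0.
Qed.

Lemma row_sum_le1 : row_sum_le 1 (1 : 'M[R]_n).
Proof.
move=> i; rewrite (bigD1 i) //= mxE eqxx normr1 big1 ?addr0 // => j ji.
by rewrite mxE eq_sym (negPf ji) normr0.
Qed.

Lemma row_sum_leD c d A B :
  row_sum_le c A -> row_sum_le d B -> row_sum_le (c + d) (A + B).
Proof.
move=> Ac Bd i; apply: le_trans (lerD (Ac i) (Bd i)).
by rewrite -big_split /=; apply: ler_sum => j _; rewrite mxE ler_normD.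
Qed.

Lemma row_sum_leZ c a A : 0 <= a -> row_sum_le c A -> row_sum_le (a * c) (a *: A).
Proof.
move=> a0 Ac i; apply: le_trans (ler_wpM2l a0 (Ac i)).
by rewrite mulr_sumr; apply: ler_sum => j _; rewrite mxE normrM ger0_norm.
Qed.

Lemma row_sum_leM c d A B : 0 <= d ->
  row_sum_le c A -> row_sum_le d B -> row_sum_le (c * d) (A * B).
Proof.
move=> d0 Ac Bd i; apply: le_trans (ler_wpM2r d0 (Ac i)).
apply: (@le_trans _ _ (\sum_j \sum_k `|A i k| * `|B k j|)).
  apply: ler_sum => j _; rewrite mxE; apply: le_trans (ler_norm_sum _ _ _) _.
  by apply: ler_sum => k _; rewrite normrM.
rewrite exchange_big mulr_suml; apply: ler_sum => k _.
by rewrite -mulr_sumr ler_wpM2l.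
Qed.

Lemma row_sum_leX c A m : 0 <= c -> row_sum_le c A -> row_sum_le (c ^+ m) (A ^+ m).
Proof.
move=> c0 Ac; elim: m => [|m IH]; first by rewrite !expr0; exact: row_sum_le1.
by rewrite !exprS; apply: row_sum_leM => //; rewrite exprn_ge0.
Qed.

(** Telescoping: each of the [m] replacements of a factor [A] by [B] costs [d] times a product of
    norms. *)
Lemma row_sum_le_expr_sub r d A B m : 1 <= r -> 0 <= d ->
  row_sum_le r A -> row_sum_le r B -> row_sum_le d (A - B) ->
  row_sum_le (m%:R * d * r ^+ m) (A ^+ m - B ^+ m).
Proof.
move=> r1 d0 Ar Br ABd; have r0 : 0 <= r by lra.
elim: m => [|m IH].
  by rewrite !expr0 subrr !mul0r => i; rewrite big1 // => j _; rewrite mxE normr0.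
have -> : A ^+ m.+1 - B ^+ m.+1 = A * (A ^+ m - B ^+ m) + (A - B) * B ^+ m.
  by rewrite !exprS mulrBr mulrBl addrA subrK.
apply: row_sum_le_weak (row_sum_leD (row_sum_leM _ Ar IH) (row_sum_leM _ ABd
  (row_sum_leX m r0 Br))); rewrite ?mulr_ge0 ?exprn_ge0 //.
rewrite exprS -natr1; have : d * r ^+ m <= d * (r * r ^+ m).
  by rewrite ler_wpM2l // ler_peMl // exprn_ge0.
lra.
Qed.

Lemma mxtrace_le_row_sum c A : row_sum_le c A -> \tr A <= n%:R * c.
Proof.
move=> Ac; rewrite mulrC mulr_natr -[n in leRHS]card_ord -sumr_const.
apply: ler_sum => i _; apply: le_trans (ler_norm _) _; apply: le_trans (Ac i).
by rewrite (bigD1 i) //= lerDl sumr_ge0.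
Qed.

End RowSumBound.

Section AsymptoticOrder.
Context {R : realType}.
Implicit Types u v w : nat -> R.

(** Inequality up to O(1 / 2^j). It composes along finitely many steps without tracking the
    constants, so [j] can be chosen once at the very end. *)
Definition asymp_le u v := exists K : R, forall j, u j <= v j + K / (2 ^ j)%:R.

Lemma asymp_le_of u v : (forall j, u j <= v j) -> asymp_le u v.
Proof. by move=> uv; exists 0 => j; rewrite mul0r addr0. Qed.

Lemma asymp_le_trans v u w : asymp_le u v -> asymp_le v w -> asymp_le u w.
Proof.
move=> [K uv] [L vw]; exists (L + K) => j; apply: le_trans (uv j) _.
by rewrite mulrDl addrA lerD2r.
Qed.

Lemma asymp_leZ a u v : 0 <= a -> asymp_le u v ->
  asymp_le (fun j => a * u j) (fun j => a * v j).
Proof.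
move=> a0 [K uv]; exists (a * K) => j.
by rewrite -mulrA -mulrDr ler_wpM2l.
Qed.

Lemma asymp_le_sum (I : finType) (P : pred I) (u v : I -> nat -> R) :
  (forall i, P i -> asymp_le (u i) (v i)) ->
  asymp_le (fun j => \sum_(i | P i) u i j) (fun j => \sum_(i | P i) v i j).
Proof.
move=> uv; have [K KP] : exists K : I -> R, forall i, P i ->
    forall j, u i j <= v i j + K i / (2 ^ j)%:R.
  suff /choice[K KP] : forall i, exists K : R, P i ->
      forall j, u i j <= v i j + K / (2 ^ j)%:R by exists K.
  move=> i; have [Pi|] := boolP (P i); last by exists 0.
  by have [K KP] := uv i Pi; exists K.
exists (\sum_(i | P i) K i) => j; rewrite mulr_suml -big_split /=.
by apply: ler_sum => i Pi; exact: KP.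
Qed.

End AsymptoticOrder.

Section TraceExponential.
Context {R : realType} {n : nat}.
Implicit Types A B H X Pi : 'M[R]_n.

(* [mexp j H] tends to the exponential of [H]; the exponent is even, which makes
   it a square. *)
Definition mexp j H : 'M[R]_n := (1 + (2 ^ j.+1)%:R^-1 *: H) ^+ (2 ^ j.+1).

(** Weighting by the projection [Pi] makes the value at [H = 0] equal to the rank of [Pi] instead of
    the dimension of the ambient space. *)
Definition trexp Pi j H : R := \tr (Pi * mexp j H).

Lemma mexp_sqr j H : H^T = H -> exists2 B, B^T = B & mexp j H = B ^+ 2.
Proof.
move=> Hs; exists ((1 + (2 ^ j.+1)%:R^-1 *: H) ^+ (2 ^ j)).
  by rewrite trmx_expr raddfD /= linearZ /= trmx1 Hs.
by rewrite -exprM -expnSr.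
Qed.

Lemma compound_interest_le_expR (h : R) N : 0 <= h ->
  (1 + N.+1%:R^-1 * h) ^+ N.+1 <= expR h.
Proof.
move=> h0; have N0 : 0 < N.+1%:R :> R by [].
have {2}-> : h = N.+1%:R^-1 * h * N.+1%:R by rewrite mulrAC mulVf ?mul1r.
rewrite expRM_natr lerXn2r ?nnegrE ?expR_ge0 ?addr_ge0 ?mulr_ge0 ?invr_ge0 //.
exact: expR_ge1Dx.
Qed.

(* Golden-Thompson up to the Lie-Trotter error. *)
Lemma mxtrace_mexpD_le H X : H^T = H -> X^T = X ->
  asymp_le (fun j => \tr (mexp j (H + X))) (fun j => \tr (mexp j H * mexp j X)).
Proof.
move=> Hs Xs; have [h h0 Hh] := row_sum_le_exists H.
have [x x0 Xx] := row_sum_le_exists X.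
set K := n%:R * (h * x * expR (h + x)).
have K0 : 0 <= K by rewrite !mulr_ge0 ?expR_ge0.
exists K => j; apply: (@le_trans _ _ (\tr (mexp j H * mexp j X) + K / (2 ^ j.+1)%:R)); last first.
  rewrite lerD2l ler_wpM2l // lef_pV2 ?posrE ?ltr0n ?expn_gt0 //.
  by rewrite ler_nat leq_pexp2l.
clear K0; rewrite {}/K.
have [N NE] : exists N, (2 ^ j.+1)%N = N.+1 by exists (2 ^ j.+1).-1; rewrite prednK ?expn_gt0.
set a : R := (2 ^ j.+1)%:R^-1; have a0 : 0 <= a by rewrite invr_ge0.
pose C := 1 + a *: H; pose D := 1 + a *: X.
have Cs : C^T = C by rewrite raddfD /= linearZ /= trmx1 Hs.
have Ds : D^T = D by rewrite raddfD /= linearZ /= trmx1 Xs.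
have CD : \tr ((C * D) ^+ (2 ^ j.+1)) <= \tr (mexp j H * mexp j X).
  exact: (mxtrace_mul_expr_le_pow2 j.+1).1.
rewrite -lerBlDl; apply: le_trans (_ : \tr (mexp j (H + X)) - \tr ((C * D) ^+ (2 ^ j.+1)) <= _).
  by rewrite lerB.
rewrite -raddfB /=.
have Cb : row_sum_le (1 + a * h) C by apply/row_sum_leD/row_sum_leZ => //; exact: row_sum_le1.
have Db : row_sum_le (1 + a * x) D by apply/row_sum_leD/row_sum_leZ => //; exact: row_sum_le1.
have ah : 0 <= a * h by exact: mulr_ge0.
have ax : 0 <= a * x by exact: mulr_ge0.
have ahx : 0 <= (a * h) * (a * x) by exact: mulr_ge0.
have CDb : row_sum_le ((1 + a * h) * (1 + a * x)) (C * D).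
  by apply: row_sum_leM => //; lra.
have Pb : row_sum_le ((1 + a * h) * (1 + a * x)) (1 + a *: (H + X)).
  have : row_sum_le (1 + a * (h + x)) (1 + a *: (H + X)).
    by apply: row_sum_leD row_sum_le1 _; apply: row_sum_leZ => //; exact: row_sum_leD.
  by apply: row_sum_le_weak; lra.
(* The factors multiply to [1 + a *: (H + X)] up to [a^2 H X]. Taking the power 1/a costs one factor
   1/a, which leaves an error of order [a]. *)
have PCDb : row_sum_le (a * (a * (h * x))) (1 + a *: (H + X) - C * D).
  have -> : 1 + a *: (H + X) - C * D = (-1) *: (a *: (a *: (H * X))).
    rewrite /C /D mulrDl mul1r mulrDr mulr1 scalemxMl scalemxMr scalerDr scaleN1r.
    move: (H * X) (1 : 'M[R]_n) => HX Id.
    by apply/matrixP => i k; rewrite !mxE; ring.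
  move=> i; under eq_bigr do rewrite mxE normrM normrN1 mul1r.
  by do 2![apply: row_sum_leZ => //]; exact: row_sum_leM.
have r1 : 1 <= (1 + a * h) * (1 + a * x) by lra.
have d0 : 0 <= a * (a * (h * x)) by rewrite !mulr_ge0.
have /mxtrace_le_row_sum := row_sum_le_expr_sub (2 ^ j.+1) r1 d0 Pb CDb PCDb.
move=> /le_trans; apply; rewrite -[leRHS]mulrA ler_wpM2l //.
have -> : (2 ^ j.+1)%:R * (a * (a * (h * x))) = a * (h * x).
  by rewrite mulrA mulfV ?mul1r // pnatr_eq0 expn_eq0.
rewrite exprMn [leRHS](_ : _ = a * (h * x) * (expR h * expR x)); last by rewrite expRD; ring.
rewrite ler_wpM2l ?mulr_ge0 //.
by rewrite ler_pM ?exprn_ge0 ?addr_ge0 // /a NE compound_interest_le_expR.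
Qed.

Lemma proj_mexp Pi j H : Pi * H = H -> (1 - Pi) * mexp j H = 1 - Pi.
Proof.
move=> PH; have QH : (1 - Pi) * H = 0 by rewrite mulrBl mul1r PH subrr.
rewrite /mexp; move: (_^-1) => a; elim: (2 ^ j.+1)%N => [|m IH]; first by rewrite expr0 mulr1.
by rewrite exprS mulrA mulrDr mulr1 scalemxMr QH scaler0 addr0 IH.
Qed.

(** Off the range of [Pi] the exponential is the identity. This passes between the full trace,
    needed for Golden-Thompson, and the projected one. *)
Lemma mxtrace_mexp Pi j H : Pi * H = H ->
  \tr (mexp j H) = trexp Pi j H + \tr (1 - Pi).
Proof.
move=> PH; rewrite -[in RHS](proj_mexp j PH) /trexp -raddfD /=.
by rewrite -mulrDl addrC subrK mul1r.
Qed.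

(** Golden-Thompson separates [H] from the increment, whose exponential is at most [1 + X + 2 X^2].
    The mean of the linear term vanishes and that of the quadratic term is at most [v *: Pi]. *)
Lemma trexp_step (I : finType) (P : pred I) (q : I -> R) (X : I -> 'M[R]_n)
    Pi H (v : R) :
  (forall i, P i -> 0 <= q i) -> \sum_(i | P i) q i = 1 ->
  \sum_(i | P i) q i *: X i = 0 ->
  (forall i, P i -> psd (1 - X i)) -> (forall i, P i -> psd (1 + X i)) ->
  (forall i, P i -> Pi * X i = X i) ->
  psd (v *: Pi - 2 *: \sum_(i | P i) q i *: X i ^+ 2) ->
  H^T = H -> Pi * H = H ->
  asymp_le (fun j => \sum_(i | P i) q i * trexp Pi j (H + X i))
           (fun j => (1 + v) * trexp Pi j H).
Proof.
move=> q0 q1 qX X1 X2 PX qX2 Hs PH.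
have Xs i : P i -> (X i)^T = X i.
  move=> Pi'; have [+ _] := X2 i Pi'; rewrite raddfD /= trmx1; exact: addrI.
have : asymp_le (fun j => \sum_(i | P i) q i * \tr (mexp j (H + X i)))
    (fun j => \sum_(i | P i) q i * \tr (mexp j H * mexp j (X i))).
  apply: asymp_le_sum => i Pi'; apply: asymp_leZ; first exact: q0.
  by apply: mxtrace_mexpD_le => //; exact: Xs.
move=> /asymp_le_trans step; rewrite /asymp_le.
(* Adding the constant [\tr (1 - Pi)] to both sides replaces the projected traces on the left by
   full ones, as the weights [q] sum to 1. *)
suff [K KP] : asymp_le
    (fun j => \sum_(i | P i) q i * \tr (mexp j (H + X i)))
    (fun j => (1 + v) * trexp Pi j H + \tr (1 - Pi)).
  exists K => j; rewrite -(lerD2r (\tr (1 - Pi))) addrAC.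
  apply: le_trans (KP j); rewrite -[X in _ + X]mul1r -q1 mulr_suml -big_split /=.
  apply: ler_sum => i Pi'; rewrite -mulrDr -mxtrace_mexp //.
  by rewrite mulrDr PH PX.
apply: step; apply: asymp_le_of => j.
have [B Bs BE] := mexp_sqr j Hs; rewrite BE.
have [N NE] : exists N, (2 ^ j.+1)%N = N.+1.
  by exists (2 ^ j.+1).-1; rewrite prednK ?expn_gt0.
pose D := \sum_(i | P i) q i *: (1 + X i + 2 *: X i ^+ 2 - mexp j (X i)).
have D0 : psd D.
  apply: psd_sum => i Pi'; apply: psdZ; first exact: q0.
  by rewrite /mexp NE; apply: psd_expr_quadratic_bound; [exact: X1|exact: X2].
have DE : \sum_(i | P i) q i *: mexp j (X i) =
    1 + v *: Pi - (v *: Pi - 2 *: \sum_(i | P i) q i *: X i ^+ 2) - D.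
  rewrite opprB addrACA subrr addr0 /D.
  under [X in _ - X]eq_bigr do rewrite scalerBr 2!scalerDr.
  rewrite !(sumrB, big_split) /= qX -scaler_suml q1 scale1r addr0.
  under [X in _ - (_ + X - _)]eq_bigr do rewrite scalerA mulrC -scalerA.
  by rewrite -scaler_sumr subKr.
have tE : \tr (B ^+ 2) + v * trexp Pi j H = \tr (B ^+ 2 * (1 + v *: Pi)).
  rewrite mulrDr mulr1 scalemxMr raddfD /= mxtraceZ; congr (_ + _ * _).
  by rewrite /trexp BE; exact: mxtrace_mulC.
rewrite mulrDl mul1r addrAC -mxtrace_mexp // BE tE.
have -> : \sum_(i | P i) q i * \tr (B ^+ 2 * mexp j (X i)) =
    \tr (B ^+ 2 * \sum_(i | P i) q i *: mexp j (X i)).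
  rewrite mulr_sumr raddf_sum /=; apply: eq_bigr => i _.
  by rewrite scalemxMr mxtraceZ.
have h1 := psd_trace_sqr_mul_ge0 Bs D0.
have h2 := psd_trace_sqr_mul_ge0 Bs qX2.
by rewrite DE !mulrBr !raddfB /=; rewrite mulrBr raddfB /= in h2; lra.
Qed.

End TraceExponential.

(** * Large quadratic forms force a large trace exponential *)

Section TraceMarkov.
Context {R : realType} {n : nat}.
Implicit Types H Pi : 'M[R]_n.

Lemma dot_cauchy_schwarz (x y : 'cV[R]_n) :
  (x^T *m y) 0 0 ^+ 2 <= (x^T *m x) 0 0 * (y^T *m y) 0 0.
Proof.
have h := dot_combination_ge0 x y; move: h (dot_ge0 x) (dot_ge0 y).
move: ((x^T *m x) 0 0) ((x^T *m y) 0 0) ((y^T *m y) 0 0) => a w b h a0 b0.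
have [bp|bn] := ltrP 0 b.
  by rewrite -subr_ge0 -(pmulr_rge0 _ bp); have := h b w; lra.
have -> : b = 0 by apply/eqP; rewrite eq_le bn b0.
have [->|w0] := eqVneq w 0; first by rewrite expr0n mulr0.
(* If [b = 0] and [w] is nonzero, this coefficient makes the cross term [a + 1], so the form would
   equal -1. *)
have := h 1 ((a + 1) / (2 * w)).
have -> : 1 * ((a + 1) / (2 * w)) * w *+ 2 = a + 1 by field.
by have -> : b = 0; [apply/eqP; rewrite eq_le bn b0|lra].
Qed.

Lemma psd_cauchy_schwarz (y : 'cV[R]_n) :
  psd ((y^T *m y) 0 0 *: (1 : 'M[R]_n) - y *m y^T).
Proof.
split=> [|x]; first by rewrite raddfB /= linearZ /= trmx1 trmx_mul trmxK.
have mul11 (A B : 'M[R]_1) : (A *m B) 0 0 = A 0 0 * B 0 0 by rewrite mxE big_ord1.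
have yx : (y^T *m x) 0 0 = (x^T *m y) 0 0 by rewrite -[y^T *m x]trmxK trmx_mul trmxK mxE.
have -> : (1 : 'M[R]_n) = 1%:M by [].
rewrite mulmxBr mulmxBl -scalemxAr -scalemxAl mulmx1 !mulmxA -[_ *m y *m _ *m x]mulmxA.
have -> (A B : 'M[R]_1) : (A - B) 0 0 = A 0 0 - B 0 0 by rewrite !mxE.
rewrite mul11 yx [X in X - _]mxE -expr2 mulrC subr_ge0.
exact: dot_cauchy_schwarz.
Qed.

Lemma trexp_ge0 Pi j H : psd Pi -> H^T = H -> 0 <= trexp Pi j H.
Proof.
move=> P0 Hs; have [B Bs BE] := mexp_sqr j Hs; rewrite /trexp BE.
have -> : \tr (Pi * B ^+ 2) = \tr (B ^+ 2 * Pi) by exact: mxtrace_mulC.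
exact: psd_trace_sqr_mul_ge0.
Qed.

(** For [s] in [0, 1] one has exp(s/2) <= 1/(1 - s/2) <= 1 + s; take the power [N.+1]. The lost
    factor 2 in the exponent reappears in the tail bound. *)
Lemma expR_half_le_compound_interest (u : R) N : 0 <= u -> u <= N.+1%:R ->
  expR (u / 2) <= (1 + N.+1%:R^-1 * u) ^+ N.+1.
Proof.
move=> u0 uN; have N0 : 0 < N.+1%:R :> R by [].
set s := N.+1%:R^-1 * u.
have s0 : 0 <= s by rewrite mulr_ge0.
have s1 : s <= 1 by rewrite /s mulrC ler_pdivrMr // mul1r.
have -> : u / 2 = s / 2 * N.+1%:R.
  by rewrite [RHS]mulrAC /s [_ * u * _]mulrAC mulVf ?mul1r.
rewrite expRM_natr lerXn2r ?nnegrE ?expR_ge0 ?addr_ge0 //.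
have h := @expR_ge1Dx R (- (s / 2)).
have : expR (s / 2) * expR (- (s / 2)) = 1 by rewrite -expRD subrr expR0.
have e0 := expR_gt0 (s / 2).
have := ler_wpM2l (ltW e0) h; nra.
Qed.

(** Since [y] lies in the range of [Pi], Cauchy-Schwarz gives [y y^T <= |y|^2 Pi], so the projected
    trace dominates the Rayleigh quotient at [y]. Jensen moves the power outside that quotient. *)
Lemma trexp_ge Pi j H (y : 'cV[R]_n) (u : R) :
  Pi^T = Pi -> Pi * Pi = Pi -> Pi * H = H -> H^T = H -> Pi *m y = y ->
  0 <= u -> u * (y^T *m y) 0 0 < (y^T *m H *m y) 0 0 ->
  (1 + (2 ^ j.+1)%:R^-1 * u) ^+ (2 ^ j.+1) <= trexp Pi j H.
Proof.
move=> Ps PP PH Hs Py u0 uH; set a : R := _^-1.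
have a0 : 0 <= a by rewrite invr_ge0.
have [B Bs BE] := mexp_sqr j Hs.
set s := (y^T *m y) 0 0 in uH *.
(* The strict inequality in [uH] excludes [y = 0]. *)
have s0 : 0 < s.
  have := dot_ge0 y; rewrite -/s le_eqVlt => /predU1P[s0|//].
  have := dot_cauchy_schwarz y (H *m y); rewrite -/s -s0 mul0r mulmxA.
  by rewrite -s0 mulr0 in uH; move/(lt_le_trans (exprn_gt0 2 uH)); rewrite ltxx.
have qE : (y^T *m B ^+ 2 *m y) 0 0 = \tr (B ^+ 2 * (y *m y^T)).
  have -> : B ^+ 2 * (y *m y^T) = B ^+ 2 *m y *m y^T by rewrite -mulmxA.
  by rewrite mxtrace_mulC /mxtrace big_ord1 -mulmxA.
have P0 : psd (s *: Pi - y *m y^T).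
  have /(psd_conj_sym Ps) := psd_cauchy_schwarz y.
  rewrite mulrBr mulrBl scalemxMr scalemxMl mulr1 PP.
  have -> : Pi * (y *m y^T) * Pi = (Pi *m y) *m (Pi *m y)^T.
    by rewrite -!mulmxE trmx_mul Ps !mulmxA.
  by rewrite Py.
have := psd_trace_sqr_mul_ge0 Bs P0; rewrite mulrBr raddfB /= -qE subr_ge0.
rewrite scalemxMr mxtraceZ => h; rewrite /trexp BE.
have -> : \tr (Pi * B ^+ 2) = \tr (B ^+ 2 * Pi) by exact: mxtrace_mulC.
rewrite -(ler_pM2l s0); apply: le_trans h; rewrite -BE mulrC.
apply: qf_expr_pow2_ge; first by rewrite raddfD /= linearZ /= trmx1 Hs.
  by rewrite addr_ge0 // mulr_ge0.
have -> : (1 : 'M[R]_n) = 1%:M by [].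
rewrite mulmxDr mulmx1 mulmxDl -scalemxAr -scalemxAl.
have -> (A C : 'M[R]_1) : (A + C) 0 0 = A 0 0 + C 0 0 by rewrite !mxE.
rewrite [X in _ <= _ + X]mxE -/s mulrDl mul1r lerD2l -mulrA.
by rewrite ler_wpM2l // ltW.
Qed.

End TraceMarkov.

(** * Revealing a negatively correlated random set *)

Section NegativelyCorrelatedSets.
Context {R : realType} {E : finType} {k : nat} (mu : {set E} -> R).
Implicit Types (F T : {set E}) (e f : E).
Hypothesis mu_ge0 : forall T, 0 <= mu T.
Hypothesis mu_card : forall T, mu T != 0 -> #|T| = k.

Definition up_mass (F : {set E}) : R := \sum_(T : {set E} | F \subset T) mu T.

Hypothesis mu_negcor : forall F e f, e != f ->
  up_mass (f |: (e |: F)) * up_mass F <= up_mass (e |: F) * up_mass (f |: F).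

(** The probability that a random set contains [e], given that it contains [F]; [mu] need not be
    normalised. If [F] has mass 0 the value is 0. *)
Definition cond_marginal F e : R := up_mass (e |: F) / up_mass F.

Lemma up_mass_ge0 F : 0 <= up_mass F.
Proof. exact: sumr_ge0. Qed.

Lemma up_mass_setU1 e F :
  up_mass (e |: F) = \sum_(T : {set E} | F \subset T) mu T * (e \in T)%:R.
Proof.
rewrite /up_mass big_mkcond [RHS]big_mkcond; apply: eq_bigr => T _.
rewrite finset.subUset finset.sub1set andbC.
by case: (F \subset T); case: (e \in T); rewrite ?mulr1 ?mulr0.
Qed.

Lemma up_mass_setU1_neq0 e F : up_mass (e |: F) != 0 -> up_mass F != 0.
Proof.
apply: contra_neq => F0; apply/eqP; rewrite eq_le up_mass_ge0 -F0 andbT.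
rewrite up_mass_setU1; apply: ler_sum => T _.
by rewrite ler_piMr // lern1 leq_b1.
Qed.

(** Double counting: a set [T] of positive mass containing [F] is met once for each of its
    [k - #|F|] elements outside [F]. *)
Lemma sum_up_mass_setU1 F (g : {set E} -> R) :
  \sum_(e | e \notin F) \sum_(T : {set E} | e |: F \subset T) mu T * g T =
  (k - #|F|)%:R * \sum_(T : {set E} | F \subset T) mu T * g T.
Proof.
rewrite (exchange_big_dep (fun T : {set E} => F \subset T)) /=; last first.
  by move=> e T _; rewrite finset.subUset => /andP[].
rewrite mulr_sumr; apply: eq_bigr => T FT.
rewrite (eq_bigl (mem (T :\: F))); last first.
  by move=> e; rewrite !inE finset.subUset finset.sub1set FT andbT.
rewrite sumr_const; have [->|T0] := eqVneq (mu T) 0.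
  by rewrite mul0r mul0rn mulr0.
by rewrite cardsD (finset.setIidPr FT) mu_card // mulr_natl.
Qed.

Lemma sum_cond_marginal F : up_mass F != 0 -> \sum_e cond_marginal F e = k%:R.
Proof.
move=> F0; rewrite -mulr_suml; apply: (mulIf F0); rewrite mulfVK //.
under eq_bigr do rewrite up_mass_setU1.
rewrite exchange_big /= mulr_sumr; apply: eq_bigr => T FT.
rewrite -mulr_sumr; have [->|T0] := eqVneq (mu T) 0; first by rewrite !mul0r mulr0.
under eq_bigr do rewrite mulrb; rewrite -big_mkcond sumr_const mu_card //.
by rewrite mulrC.
Qed.

Lemma cond_marginal_ge0 F e : 0 <= cond_marginal F e.
Proof. by rewrite divr_ge0 // up_mass_ge0. Qed.

Lemma cond_marginal_mem F e : up_mass F != 0 -> e \in F -> cond_marginal F e = 1.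
Proof.
move=> F0 eF; rewrite /cond_marginal (finset.setUidPr _) ?mulfV //.
by rewrite finset.sub1set.
Qed.

Lemma cond_marginal_setU1_le F e f : e != f -> up_mass (f |: F) != 0 ->
  cond_marginal (f |: F) e <= cond_marginal F e.
Proof.
move=> ef f0; have F0 := up_mass_setU1_neq0 f0.
rewrite ler_pdivrMr ?lt0r ?f0 ?up_mass_ge0 // mulrAC.
rewrite ler_pdivlMr ?lt0r ?F0 ?up_mass_ge0 //.
rewrite [leRHS]mulrC; apply: mu_negcor; by rewrite eq_sym.
Qed.

Lemma cond_marginal_le_set0 F e : e \notin F -> up_mass F != 0 ->
  cond_marginal F e <= cond_marginal finset.set0 e.
Proof.
have [m] := ubnP #|F|; elim: m F => // m IH F Fm eF F0.
have [->//|[f fF]] := finset.set_0Vmem F.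
have FE : F = f |: (F :\ f) by rewrite finset.setD1K.
rewrite FE; apply: le_trans (cond_marginal_setU1_le _ _) _; rewrite -?FE //.
  by apply: contraNneq eF => ->.
apply: IH; first by move: Fm; rewrite (cardsD1 f F) fF.
  by rewrite !inE negb_and eF orbT.
by apply: (@up_mass_setU1_neq0 f); rewrite -FE.
Qed.

End NegativelyCorrelatedSets.

(** * The matrix martingale of the revealed edges *)

Section SequentialRevelation.
Context {R : realType} {E : finType} {k n : nat}.
Variables (mu : {set E} -> R) (A : E -> 'M[R]_n).
Implicit Types (F T : {set E}) (e f : E).
Hypothesis mu_ge0 : forall T, 0 <= mu T.
Hypothesis mu_card : forall T, mu T != 0 -> #|T| = k.
Hypothesis mu_negcor : forall F e f, e != f ->
  up_mass mu (f |: (e |: F)) * up_mass mu F <=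
  up_mass mu (e |: F) * up_mass mu (f |: F).
Hypothesis A_psd : forall e, psd (A e).
Hypothesis A_le1 : forall e, psd (1 - A e).

Local Notation Z := (up_mass mu).
Local Notation l := (cond_marginal mu).

(** The conditional expectation of the sum of [A e] over the random set, given that it contains [F]:
    the martingale that starts at [Pi]. *)
Definition cond_mean F : 'M[R]_n := \sum_e l F e *: A e.

Local Notation Pi := (cond_mean finset.set0).
Hypothesis Pi_A : forall e, Pi * A e = A e.

Lemma cond_mean_sym F : (cond_mean F)^T = cond_mean F.
Proof.
rewrite raddf_sum; apply: eq_bigr => e _ /=.
by rewrite linearZ /=; have [-> _] := A_psd e.
Qed.

Lemma proj_cond_mean F : Pi * cond_mean F = cond_mean F.
Proof.
rewrite [in LHS]/(cond_mean F) mulr_sumr; apply: eq_bigr => e _.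
by rewrite scalemxMr Pi_A.
Qed.

Section Step.
Variable F : {set E}.
Hypothesis F0 : Z F != 0.
Hypothesis Fk : (#|F| < k)%N.

(** [d] elements are still hidden, and [q e] is the probability that a uniformly chosen hidden one
    is [e]. [P] discards the elements of probability 0, after which there is nothing to condition
    on. *)
Let d : R := (k - #|F|)%:R.
Let P e := (e \notin F) && (Z (e |: F) != 0).
Let q e := l F e / d.
Let Y e := cond_mean (e |: F) - cond_mean F.

Let d_gt0 : 0 < d. Proof. by rewrite ltr0n subn_gt0. Qed.
Let q_ge0 e : 0 <= q e.
Proof. by rewrite divr_ge0 ?(ltW d_gt0) // cond_marginal_ge0. Qed.

Let sum_P (V : lmodType R) (g : E -> V) :
  \sum_(e | P e) l F e *: g e = \sum_(e | e \notin F) l F e *: g e.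
Proof.
rewrite [RHS](bigID (fun e => Z (e |: F) != 0)) /= [X in _ = _ + X]big1 ?addr0 //.
by move=> e /andP[_]; rewrite negbK /cond_marginal => /eqP ->; rewrite mul0r scale0r.
Qed.

Lemma step_weight_sum : \sum_(e | P e) q e = 1.
Proof.
have lE : \sum_(e | P e) l F e = \sum_(e | e \notin F) l F e.
  have := sum_P (fun=> 1 : R^o); rewrite -!scaler_suml /GRing.scale /=.
  by rewrite !mulr1.
rewrite -mulr_suml lE -mulr_suml; apply: (mulIf F0); rewrite mul1r mulrAC mulfVK //.
have := sum_up_mass_setU1 mu_card F (fun=> 1).
under eq_bigr do under eq_bigr do rewrite mulr1.
under [in RHS]eq_bigr do rewrite mulr1.
by move=> ->; rewrite mulrAC mulfV ?mul1r // gt_eqF.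
Qed.

(** The martingale property. Coefficient by coefficient it is the double counting identity applied
    to the indicator of [f]. *)
Lemma step_mean0 : \sum_(e | P e) q e *: Y e = 0.
Proof.
under eq_bigr do rewrite scalerBr.
rewrite sumrB -scaler_suml step_weight_sum scale1r.
apply/eqP; rewrite subr_eq0; apply/eqP.
under eq_bigr do rewrite /q mulrC -scalerA.
rewrite -scaler_sumr sum_P /cond_mean.
under eq_bigr do rewrite scaler_sumr.
rewrite exchange_big /= scaler_sumr; apply: eq_bigr => f _.
under eq_bigr do rewrite scalerA.
rewrite -scaler_suml scalerA; congr (_ *: _).
apply: (mulfI (lt0r_neq0 d_gt0)); rewrite mulVKf ?lt0r_neq0 //.
apply: (mulIf F0); rewrite mulr_suml -mulrA /cond_marginal mulfVK //.
rewrite (up_mass_setU1 _ f) -(sum_up_mass_setU1 mu_card F (fun T => (f \in T)%:R)).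
apply: eq_bigr => e _; rewrite -up_mass_setU1.
(* If [e |: F] has mass 0 its marginals are 0 by convention, which agrees with the mass of the
   larger set also being 0. *)
have [e0|e0] := eqVneq (Z (e |: F)) 0; last by rewrite mulrAC mulfVK // mulrC mulfVK.
rewrite e0 !mul0r; apply/esym/eqP; apply: contraTT isT => fe0.
by move: (up_mass_setU1_neq0 mu_ge0 fe0); rewrite e0 eqxx.
Qed.

(* [D e] collects the marginals lost by all edges when [e] is revealed; they sum
   to 1, so that [D e] is a convex combination of the [A f]. *)
Let D e := A e - Y e.

Let D_combination e : P e -> exists2 c : E -> R, (forall f, 0 <= c f) &
  \sum_f c f = 1 /\ D e = \sum_f c f *: A f.
Proof.
move=> /andP[eF e0]; exists (fun f => l F f - l (e |: F) f + (f == e)%:R).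
  move=> f; have [->|fe] := eqVneq f e.
    rewrite (cond_marginal_mem e0) ?setU11 // subrK; exact: cond_marginal_ge0.
  by rewrite addr0 subr_ge0; apply: cond_marginal_setU1_le.
split.
  rewrite big_split sumrB /= !(sum_cond_marginal mu_card) // subrr add0r.
  by rewrite (bigD1 e) //= eqxx big1 ?addr0 // => f /negPf ->.
under eq_bigr do rewrite scalerDl scalerBl.
rewrite big_split sumrB /= [X in _ + X](bigD1 e) //= eqxx scale1r.
rewrite [X in _ + (_ + X)]big1 ?addr0; last by move=> f /negPf ->; rewrite scale0r.
by rewrite /D /Y opprB addrC.
Qed.

Let D_psd e : P e -> psd (D e).
Proof.
by move=> /D_combination[c c0 [_ ->]]; apply: psd_sum => f _; exact: psdZ.
Qed.

Let D_le1 e : P e -> psd (1 - D e).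
Proof.
move=> /D_combination[c c0 [c1 ->]].
rewrite -[1]scale1r -c1 scaler_suml -sumrB.
by apply: psd_sum => f _; rewrite -scalerBr; exact: psdZ.
Qed.

Lemma step_le1 e : P e -> psd (1 - Y e).
Proof.
move=> Pe; have -> : 1 - Y e = (1 - A e) + D e by rewrite /D addrA subrK.
by apply: psdD => //; exact: D_psd.
Qed.

Lemma step_ge1 e : P e -> psd (1 + Y e).
Proof.
move=> Pe; have -> : 1 + Y e = (1 - D e) + A e by rewrite /D opprB -addrA subrK.
by apply: psdD => //; exact: D_le1.
Qed.

(** The square of [Y = A - D] is at most [2 (A + D) = 4 A - 2 Y], and [Y] has mean 0. The mean of
    [A] is 1/d times a sum over hidden edges, whose marginals given [F] are at most the
    unconditional ones; that sum is at most [Pi]. *)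
Lemma step_variance :
  psd ((4 / d) *: Pi - \sum_(e | P e) q e *: Y e ^+ 2).
Proof.
have -> : (4 / d) *: Pi - \sum_(e | P e) q e *: Y e ^+ 2 =
    (4 / d) *: (Pi - \sum_(e | P e) l F e *: A e) +
    \sum_(e | P e) q e *: (2 *: (A e + D e) - Y e ^+ 2).
  under [X in _ = _ + X]eq_bigr do rewrite scalerBr.
  rewrite sumrB addrA; congr (_ - _).
  rewrite scalerBr -addrA -[LHS]addr0; congr (_ + _).
  apply/esym/eqP; rewrite addrC subr_eq0; apply/eqP.
  have -> : \sum_(e | P e) q e *: (2 *: (A e + D e)) =
      \sum_(e | P e) (4 *: (q e *: A e) - 2 *: (q e *: Y e)).
    apply: eq_bigr => e _; rewrite /D.
    by apply/matrixP => a b; rewrite !mxE; ring.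
  rewrite sumrB -!scaler_sumr step_mean0 scaler0 subr0 scaler_sumr [RHS]scaler_sumr.
  by apply: eq_bigr => e _; rewrite !scalerA; congr (_ *: _); rewrite /q; ring.
apply: psdD.
  apply: psdZ; first by rewrite divr_ge0 // ltW.
  rewrite sum_P /cond_mean [X in X - _](bigID (fun e => e \notin F)) /=.
  rewrite addrAC -sumrB; apply: psdD; apply: psd_sum => e eF.
    rewrite -scalerBl; apply: psdZ => //; rewrite subr_ge0.
    exact: cond_marginal_le_set0.
  by apply: psdZ => //; exact: cond_marginal_ge0.
apply: psd_sum => e Pe; apply: psdZ => //.
(* (A - D)^2 <= 2 A^2 + 2 D^2 <= 2 A + 2 D *)
have -> : 2 *: (A e + D e) - Y e ^+ 2 = 2 *: (A e - A e ^+ 2) +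
    2 *: (D e - D e ^+ 2) + (A e + D e) ^+ 2.
  have -> : Y e = A e - D e by rewrite /D subKr.
  rewrite !expr2 !(mulrBl, mulrBr, mulrDl, mulrDr).
  move: (A e * A e) (A e * D e) (D e * A e) (D e * D e) => ? ? ? ?.
  by apply/matrixP => a b; rewrite !mxE; ring.
apply: psdD; first apply: psdD.
- by apply: psdZ => //; exact: psd_sub_sqr.
- by apply: psdZ => //; apply: psd_sub_sqr; [exact: D_psd|exact: D_le1].
- by apply: psd_sqr; rewrite raddfD /=; have [-> _] := A_psd e; have [-> _] := D_psd Pe.
Qed.

Lemma revelation_step (theta : R) (H : 'M[R]_n) :
  `|theta| <= 1 -> H^T = H -> Pi * H = H ->
  asymp_le
    (fun j => \sum_(e | e \notin F) Z (e |: F) *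
                trexp Pi j (H + theta *: cond_mean (e |: F)))
    (fun j => d * (1 + 8 * theta ^+ 2 / d) * Z F *
                trexp Pi j (H + theta *: cond_mean F)).
Proof.
move=> th Hs PH; have th1 : - 1 <= theta <= 1 by rewrite -ler_norml.
pose X e := theta *: Y e.
have : asymp_le
    (fun j => \sum_(e | P e) q e * trexp Pi j (H + theta *: cond_mean F + X e))
    (fun j => (1 + 8 * theta ^+ 2 / d) * trexp Pi j (H + theta *: cond_mean F)).
  apply: trexp_step.
  - by move=> e _; exact: q_ge0.
  - exact: step_weight_sum.
  - under eq_bigr do rewrite /X scalerA mulrC -scalerA.
    by rewrite -scaler_sumr step_mean0 scaler0.
  - move=> e Pe.
    (* A convex combination, because [theta] lies in [-1, 1]; this also handles negative [theta]. *)
    have -> : 1 - X e = ((1 + theta) / 2) *: (1 - Y e) + ((1 - theta) / 2) *: (1 + Y e).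
      move: (1 : 'M[R]_n) => Id.
      by apply/matrixP => a b; rewrite /X !mxE; field.
    apply: psdD; apply: psdZ; try (lra); [exact: step_le1|exact: step_ge1].
  - move=> e Pe.
    have -> : 1 + X e = ((1 - theta) / 2) *: (1 - Y e) + ((1 + theta) / 2) *: (1 + Y e).
      move: (1 : 'M[R]_n) => Id.
      by apply/matrixP => a b; rewrite /X !mxE; field.
    apply: psdD; apply: psdZ; try (lra); [exact: step_le1|exact: step_ge1].
  - by move=> e _; rewrite /X scalemxMr mulrBr !proj_cond_mean.
  - have -> : (8 * theta ^+ 2 / d) *: Pi - 2 *: \sum_(e | P e) q e *: X e ^+ 2 =
        (2 * theta ^+ 2) *: ((4 / d) *: Pi - \sum_(e | P e) q e *: Y e ^+ 2).
      rewrite scalerBr scalerA; congr (_ *: _ - _); first by ring.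
      rewrite -scalerA; congr (_ *: _); rewrite scaler_sumr; apply: eq_bigr => e _.
      by rewrite /X scalemx_expr !scalerA mulrC.
    by apply: psdZ step_variance; rewrite mulr_ge0 // sqr_ge0.
  - by rewrite raddfD /= linearZ /= cond_mean_sym Hs.
  - by rewrite mulrDr scalemxMr proj_cond_mean PH.
(* Multiplying by [d * Z F] turns the weight [q e] into the mass of [e |: F], so the discarded edges
   return as zero terms. *)
move=> /(asymp_leZ (_ : 0 <= d * Z F)) => /(_ (mulr_ge0 (ltW d_gt0) (up_mass_ge0 mu_ge0 F))).
move=> main; apply: (asymp_le_trans (asymp_le_of _)
  (asymp_le_trans main (asymp_le_of _))) => j; last first.
  by rewrite le_eqVlt; apply/orP; left; apply/eqP; ring.
rewrite mulr_sumr (bigID (fun e => Z (e |: F) != 0)) /= [X in _ + X]big1 ?addr0; last first.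
  by move=> e /andP[_]; rewrite negbK => /eqP ->; rewrite mul0r.
apply: ler_sum => e _; rewrite mulrA.
have -> : d * Z F * q e = Z (e |: F).
  rewrite /q /cond_marginal mulrC mulrA divfK ?gt_eqF //.
  by rewrite divfK.
by rewrite /X /Y scalerBr -[H + _ + _]addrA [theta *: cond_mean F + _]addrC subrK.
Qed.

End Step.

(** Induction on the number of hidden elements. Revealing one more costs [1 + 8 theta^2 / i] with
    [i] still hidden, so the factors multiply to a power of k rather than an exponential in k. *)
Lemma revelation_process F (theta : R) (H : 'M[R]_n) :
  `|theta| <= 1 -> H^T = H -> Pi * H = H ->
  asymp_le
    (fun j => \sum_(T : {set E} | F \subset T) mu T *
                trexp Pi j (H + theta *: \sum_(e in T) A e))
    (fun j => \prod_(i < k - #|F|) (1 + 8 * theta ^+ 2 / i.+1%:R) *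
                (Z F * trexp Pi j (H + theta *: cond_mean F))).
Proof.
move=> th Hs PH; have [m mE] : exists m, m = (k - #|F|)%N by eexists.
rewrite -mE; elim: m F mE => [|m IH] F mE.
  apply: asymp_le_of => j; rewrite big_ord0 mul1r.
  have kF : (k <= #|F|)%N by rewrite -subn_eq0 -mE.
  (* Truncated subtraction gives only [k <= #|F|], which still rules out a proper superset of size
     [k]. *)
  have TF T : F \subset T -> T != F -> mu T = 0.
    move=> FT; apply: contraNeq => T0; rewrite eq_sym eqEcard FT /=.
    by rewrite (mu_card T0).
  have ZF : Z F = mu F.
    rewrite /up_mass (bigD1 F) //= big1 ?addr0 // => T /andP[FT TnF].
    exact: TF.
  rewrite (bigD1 F) //= [X in _ + X]big1 ?addr0; last first.
    by move=> T /andP[FT TnF]; rewrite TF ?mul0r.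
  rewrite ZF; have [->|F0] := eqVneq (mu F) 0; first by rewrite !mul0r.
  suff -> : \sum_(e in F) A e = cond_mean F by [].
  rewrite /cond_mean [RHS](bigID (mem F)) /= [X in _ + X]big1 ?addr0.
    apply: eq_bigr => e eF; rewrite cond_marginal_mem ?scale1r //.
    by rewrite ZF.
  move=> e eF; rewrite /cond_marginal [Z (_ |: _)]big1 ?mul0r ?scale0r //.
  move=> T; rewrite finset.subUset finset.sub1set => /andP[eT FT].
  by apply: TF => //; apply: contraNneq eF => <-.
have [F0|F0] := eqVneq (Z F) 0.
  apply: asymp_le_of => j; rewrite F0 mul0r mulr0 big1 // => T FT.
  suff -> : mu T = 0 by rewrite mul0r.
  apply/eqP; rewrite eq_le mu_ge0 andbT -F0 /up_mass (bigD1 T) //= lerDl.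
  exact: sumr_ge0.
have Fk : (#|F| < k)%N by rewrite -subn_gt0 -mE.
have d0 : 0 < (k - #|F|)%:R :> R by rewrite ltr0n subn_gt0.
pose c := \prod_(i < m) (1 + 8 * theta ^+ 2 / i.+1%:R).
have c0 : 0 <= c.
  by apply: prodr_ge0 => i _; rewrite addr_ge0 // divr_ge0 // mulr_ge0 // sqr_ge0.
have h1 : asymp_le
    (fun j => \sum_(e | e \notin F) \sum_(T : {set E} | e |: F \subset T)
       mu T * trexp Pi j (H + theta *: \sum_(e in T) A e))
    (fun j => \sum_(e | e \notin F) c * (Z (e |: F) *
       trexp Pi j (H + theta *: cond_mean (e |: F)))).
  apply: asymp_le_sum => e eF; apply: IH.
  by rewrite cardsU1 eF add1n subnS -mE.
have h2 := asymp_leZ c0 (revelation_step F0 Fk th Hs PH).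
have h3 : asymp_le
    (fun j => \sum_(e | e \notin F) c * (Z (e |: F) *
       trexp Pi j (H + theta *: cond_mean (e |: F))))
    (fun j => c * \sum_(e | e \notin F) Z (e |: F) *
       trexp Pi j (H + theta *: cond_mean (e |: F))).
  by apply: asymp_le_of => j; rewrite mulr_sumr.
(* Dividing by [k - #|F|] undoes the double counting of each set over its next revealed element. *)
have := asymp_leZ (ltW (_ : 0 < (k - #|F|)%:R^-1)) (asymp_le_trans h1 (asymp_le_trans h3 h2)).
rewrite invr_gt0 => /(_ d0) main.
apply: (asymp_le_trans (asymp_le_of _) (asymp_le_trans main (asymp_le_of _))) => j.
  by rewrite (sum_up_mass_setU1 mu_card) mulKf // gt_eqF.
rewrite -mE big_ord_recr /= -/c le_eqVlt; apply/orP; left; apply/eqP.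
have x0 : m.+1%:R != 0 :> R by rewrite pnatr_eq0.
by move: (m.+1%:R : R) x0 => x x0; field.
Qed.

End SequentialRevelation.

(** * Spanning trees *)

Section SpanningTrees.
Context {R : realType} {n : nat} (G : wgraph R n).
Implicit Types (e f g h : edge G) (S T : {set edge G}) (phi psi : 'I_n -> R).

Definition pot_diff phi e : R := phi (src e) - phi (dst e).

(* For sets of edges, being connected and being acyclic are both expressed
   through the potentials that are constant along the edges. *)
Definition balanced S phi := forall h, h \in S -> pot_diff phi h = 0.

Lemma pot_diffB phi psi a e :
  pot_diff (fun v => phi v - a * psi v) e = pot_diff phi e - a * pot_diff psi e.
Proof. by rewrite /pot_diff; ring. Qed.

Lemma adjacent_sym S : symmetric (Defs.adjacent S).
Proof. by move=> u v; apply: eq_existsb => e; rewrite orbC. Qed.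

Lemma adjacent_edge S e : e \in S -> Defs.adjacent S (src e) (dst e).
Proof. by move=> eS; apply/existsP; exists e; rewrite eS !eqxx. Qed.

Lemma balanced_connect S phi u v :
  balanced S phi -> connect (Defs.adjacent S) u v -> phi u = phi v.
Proof.
move=> Sphi /connectP[p + ->] {v}; elim: p u => //= v p IH u.
move=> /andP[/existsP[e /andP[eS euv]] /IH <-].
move: (Sphi e eS) => /eqP; rewrite subr_eq0 => /eqP.
by case/orP: euv => /andP[/eqP -> /eqP ->].
Qed.

(** For the converse, the indicator of the component of [u] is balanced, hence constant. *)
Lemma spans_connectedP S :
  reflect (forall phi, balanced S phi -> forall u v, phi u = phi v)
          (spans_connected S).
Proof.
apply: (iffP idP) => [/forallP Sc phi Sphi u v|Sc].
  by apply: balanced_connect Sphi _; have /forallP := Sc u; exact.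
apply/forallP => u; apply/forallP => v.
pose phi w : R := (connect (Defs.adjacent S) u w)%:R.
suff : phi u = phi v.
  rewrite /phi connect0; case: connect => // /eqP.
  by rewrite oner_eq0.
apply: Sc => h hS; rewrite /pot_diff /phi.
have Sh := connect1 (adjacent_edge hS).
rewrite (same_connect_r _ Sh) ?subrr //.
exact/sym_connect_sym/adjacent_sym.
Qed.

(** Translates a simple vertex path into the darts that [is_cycle] asks for. The edges are distinct
    because the first one touches [x] and the later ones do not; the preceding dart [c] is left free
    so that a closing dart can be put in front. *)
Lemma path_darts S x p : path (Defs.adjacent S) x p -> uniq (x :: p) ->
  exists s : seq (edge G * bool),
  [/\ [seq dart_tail a | a <- s] = belast x p,
      {in s, forall a, [/\ a.1 \in S, src a.1 \in x :: p & dst a.1 \in x :: p]},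
      uniq [seq a.1 | a <- s] &
      forall c, dart_head c = x ->
        path (fun a b => dart_head a == dart_tail b) c s /\
        dart_head (last c s) = last x p].
Proof.
elim: p x => [|y p IH] x; first by exists [::].
rewrite [path _ _ _]/= [uniq _]/= => /andP[/existsP[e /andP[eS exy]] yp] /andP[xyp up].
have [s [ts Ss us cs]] := IH _ yp up.
have [b [bt bh]] : exists b, dart_tail (e, b) = x /\ dart_head (e, b) = y.
  case/orP: exy => /andP[/eqP sx /eqP dy]; first by exists false.
  by exists true; rewrite /dart_tail /dart_head.
have endx : (src e \in x :: y :: p) && (dst e \in x :: y :: p).
  by case/orP: exy => /andP[/eqP -> /eqP ->]; rewrite !inE !eqxx ?orbT.
exists ((e, b) :: s); split.
- by rewrite /= bt ts.
- move=> a; rewrite inE => /predU1P[->|/Ss[aS ax ay]]; first by case/andP: endx.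
  by split=> //; rewrite inE ?ax ?ay orbT.
- rewrite /= us andbT; apply/negP => /mapP[a /Ss[_ ax ay] ea].
  move: xyp; rewrite -bt /dart_tail /= ea; case: b {bt bh} => /=; first by rewrite ay.
  by rewrite ax.
- move=> c cx; rewrite /= cx bt eqxx /=.
  by have [-> ->] := cs (e, b) bh.
Qed.

(** Otherwise a simple path between the ends of [f], closed by [f] traversed backwards, is a
    cycle. *)
Lemma acyclic_bridge S f : acyclic S -> f \in S ->
  ~~ connect (Defs.adjacent (S :\ f)) (src f) (dst f).
Proof.
move=> Sac fS; apply/negP => /connectP[p0 p0p].
case/shortenP: p0p => p pp up _ {p0} dE; apply: Sac.
have [s [ts Ss us cs]] := path_darts pp up.
have [cp cl] := cs (f, true) erefl.
exists ((f, true) :: s); split; last first.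
  move=> a; rewrite inE => /predU1P[->//|/Ss[]].
  by rewrite !inE => /andP[_ ->].
apply/and4P; split=> //.
- by rewrite /= rcons_path cp cl /= -dE /dart_tail.
- by rewrite map_cons ts cons_uniq /dart_tail /= dE -rcons_uniq -lastI.
- rewrite /= us andbT; apply/negP => /mapP[a /Ss[+ _ _] fa].
  by rewrite !inE -fa eqxx.
Qed.

(** The rest of a cycle through [f] joins the ends of [f], and it avoids [f] because the edges of a
    cycle are distinct. *)
Lemma bridges_acyclic S :
  (forall f, f \in S -> ~~ connect (Defs.adjacent (S :\ f)) (src f) (dst f)) -> acyclic S.
Proof.
move=> br [[|a s] [/and4P[// _ cs _ us] sS]].
have aS : a.1 \in S by apply: sS; rewrite inE eqxx.
move: cs us; rewrite /= rcons_path => /andP[cp /eqP cl] /andP[as_ _].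
have s'S b : b \in s -> b.1 \in S :\ a.1.
  move=> bs; rewrite !inE sS ?inE ?bs ?orbT // andbT.
  by apply: contraNneq as_ => <-; exact: map_f.
have path_connect c r : path (fun a b => dart_head a == dart_tail b) c r ->
    {subset r <= s} ->
    connect (Defs.adjacent (S :\ a.1)) (dart_head c) (dart_head (last c r)).
  elim: r c => [|b r IH] c /=; first by rewrite connect0.
  move=> /andP[/eqP cb br'] rs; apply: connect_trans (IH _ br' _); last first.
    by move=> z zr; apply: rs; rewrite inE zr orbT.
  rewrite cb; apply: connect1.
  have bS : b.1 \in S :\ a.1 by apply: s'S; apply: rs; rewrite inE eqxx.
  rewrite /dart_tail /dart_head; case: b.2; last exact: adjacent_edge.
  by rewrite adjacent_sym; exact: adjacent_edge.
have := path_connect a s cp (fun _ => id); rewrite cl.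
have csym := sym_connect_sym (@adjacent_sym (S :\ a.1)).
by rewrite /dart_head /dart_tail; case: a.2; [|rewrite csym]; apply/negP/br.
Qed.

Lemma balanced_acyclic S :
  (forall f, f \in S -> exists2 phi, balanced (S :\ f) phi & pot_diff phi f != 0) ->
  acyclic S.
Proof.
move=> Sphi; apply: bridges_acyclic => f fS.
have [phi Sf pf] := Sphi f fS; apply: contra_neqN pf => /(balanced_connect Sf).
by rewrite /pot_diff => ->; rewrite subrr.
Qed.

Lemma spanning_treeP S :
  reflect (spans_connected S /\ acyclic S) (spanning_tree S).
Proof.
apply: (iffP andP) => -[Sc Sa]; split=> //; first exact/asboolP.
by apply/asboolP.
Qed.

(* [side T f] is the indicator of the part of the tree [T] on the source side of
   [f]; [coef T f e] is the coefficient of [incidence f] when [incidence e] is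
   written in the basis given by [T]. *)
Definition side T f : 'I_n -> R :=
  fun v => (connect (Defs.adjacent (T :\ f)) (src f) v)%:R.

Definition coef T f e : R := pot_diff (side T f) e.

Lemma balanced_side T f : balanced (T :\ f) (side T f).
Proof.
move=> h hT; rewrite /pot_diff /side.
rewrite (same_connect_r _ (connect1 (adjacent_edge hT))) ?subrr //.
exact/sym_connect_sym/adjacent_sym.
Qed.

Lemma coef_self T f : acyclic T -> f \in T -> coef T f f = 1.
Proof.
move=> Ta fT; rewrite /coef /pot_diff /side connect0.
by rewrite (negPf (acyclic_bridge Ta fT)) subr0.
Qed.

Lemma coef_tree T f g : acyclic T -> f \in T -> g \in T ->
  coef T f g = (f == g)%:R.
Proof.
move=> Ta fT gT; have [->|fg] := eqVneq f g; first by rewrite coef_self.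
by apply: balanced_side; rewrite !inE eq_sym fg.
Qed.

Lemma coef_sqr T f e : coef T f e != 0 -> coef T f e * coef T f e = 1.
Proof.
rewrite /coef /pot_diff /side; do 2![case: connect] => //=; rewrite ?subrr ?eqxx //.
- by rewrite subr0 mulr1.
- by rewrite sub0r mulrNN mulr1.
Qed.

(** Subtracting from [phi] its drops along [T] times the side indicators leaves a potential balanced
    on [T], hence constant. *)
Lemma pot_diff_expand T phi e : spanning_tree T ->
  pot_diff phi e = \sum_(f in T) coef T f e * pot_diff phi f.
Proof.
move=> /spanning_treeP[/spans_connectedP Tc Ta].
pose psi v := phi v - \sum_(f in T) pot_diff phi f * side T f v.
have psiE g : pot_diff psi g =
    pot_diff phi g - \sum_(f in T) coef T f g * pot_diff phi f.
  have -> : \sum_(f in T) coef T f g * pot_diff phi f =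
      \sum_(f in T) pot_diff phi f * side T f (src g) -
      \sum_(f in T) pot_diff phi f * side T f (dst g).
    by rewrite -sumrB; apply: eq_bigr => f _; rewrite /coef /pot_diff; ring.
  by rewrite /pot_diff /psi; ring.
have Tpsi : balanced T psi.
  move=> g gT; rewrite psiE (bigD1 g) //= coef_self // mul1r big1 ?addr0 ?subrr //.
  by move=> f /andP[fT fg]; rewrite coef_tree // (negPf fg) mul0r.
move/eqP: (Tc _ Tpsi (src e) (dst e)).
by rewrite -subr_eq0 -/(pot_diff psi e) psiE subr_eq0 => /eqP.
Qed.

Lemma incidence_expand T e : spanning_tree T ->
  incidence e = \sum_(f in T) coef T f e *: incidence f.
Proof.
move=> Tt; apply/matrixP => v j; rewrite !mxE summxE.
rewrite -[LHS]/(pot_diff (fun u => (v == u)%:R) e) (pot_diff_expand _ _ Tt).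
by apply: eq_bigr => f _; rewrite !mxE.
Qed.

(** Each cardinality is the trace of a product of the two change-of-basis matrices, taken in one
    order or the other. *)
Lemma spanning_tree_card T S : spanning_tree T -> spanning_tree S -> #|T| = #|S|.
Proof.
have cardE A B : spanning_tree A -> spanning_tree B ->
    #|A|%:R = \sum_(f in A) \sum_(g in B) coef B g f * coef A f g :> R.
  move=> At Bt; have [_ Aa] := spanning_treeP _ At.
  rewrite -sum1_card natr_sum; apply: eq_bigr => f fA.
  by rewrite -(coef_self Aa fA) /coef (pot_diff_expand _ _ Bt).
move=> Tt St; apply/eqP; rewrite -(eqr_nat R) (cardE T S) // (cardE S T) //.
rewrite exchange_big /=; apply/eqP; apply: eq_bigr => g _; apply: eq_bigr => f _.
exact: mulrC.
Qed.

(** Basis exchange together with its sign: the coefficient survives the swap, being its own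
    inverse. *)
Lemma exchange T f e : spanning_tree T -> f \in T -> coef T f e != 0 ->
  [/\ spanning_tree (e |: (T :\ f)), e \notin T :\ f &
      coef (e |: (T :\ f)) e f = coef T f e].
Proof.
move=> Tt fT c0; have [/spans_connectedP Tc Ta] := spanning_treeP _ Tt.
have eT : e \notin T :\ f.
  by apply: contra_neqN c0 => eT; exact: balanced_side.
(* Removing the drop of [phi] across [f] gives a constant potential; looking at [e], where the side
   of [f] jumps, shows that this drop was 0. *)
have Sc phi : balanced (e |: (T :\ f)) phi -> forall u v, phi u = phi v.
  move=> Sphi; pose psi v := phi v - pot_diff phi f * side T f v.
  have Tpsi : balanced T psi.
    move=> h hT; rewrite /psi pot_diffB -/(coef T f h) coef_tree //.
    have [->|fh] := eqVneq f h; first by rewrite mulr1 subrr.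
    by rewrite mulr0 subr0; apply: Sphi; rewrite !inE hT (eq_sym h f) fh orbT.
  have : pot_diff psi e = 0 by rewrite /pot_diff (Tc _ Tpsi (src e) (dst e)) subrr.
  rewrite /psi pot_diffB Sphi ?setU11 // sub0r => /eqP.
  rewrite oppr_eq0 mulf_eq0 (negPf c0) orbF => /eqP pf0 u v.
  by have := Tc _ Tpsi u v; rewrite /psi pf0 !mul0r !subr0.
have St : spanning_tree (e |: (T :\ f)).
  apply/spanning_treeP; split; first exact/spans_connectedP.
  apply: balanced_acyclic => g; rewrite !inE => gS.
  have [->|ge] := eqVneq g e.
    exists (side T f) => // h; rewrite !inE => /andP[/negPf -> /=] hT.
    by apply: balanced_side; rewrite !inE.
  move: gS; rewrite (negPf ge) /= => /andP[gf gT].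
  (* The multiple of [side T f] is chosen to cancel the jump of [side T g] across the new edge
     [e]. *)
  exists (fun v => side T g v - (coef T g e / coef T f e) * side T f v).
    move=> h; rewrite !inE pot_diffB -!/(coef _ _ _) => /andP[hg].
    have [->|he] /= := eqVneq h e; first by rewrite divfK ?subrr.
    move=> /andP[hf hT]; rewrite (coef_tree Ta gT hT) (coef_tree Ta fT hT).
    by rewrite (eq_sym g) (negPf hg) (eq_sym f) (negPf hf) mulr0 subrr.
  rewrite pot_diffB -!/(coef _ _ _) (coef_tree Ta gT gT) (coef_tree Ta fT gT).
  rewrite eqxx (eq_sym f) (negPf gf).
  by rewrite mulr0 subr0 oner_eq0.
split=> //.
have [_ Sa] := spanning_treeP _ St.
have : pot_diff (side T f) f = coef (e |: (T :\ f)) e f * coef T f e.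
  rewrite (pot_diff_expand _ _ St) (bigD1 e) ?setU11 //= big1 ?addr0 // => h.
  rewrite !inE => /andP[hS /negPf he]; move: hS; rewrite he /= => hT.
  by rewrite -/(coef T f h) [coef T f h]balanced_side ?inE // mulr0.
rewrite -/(coef T f f) coef_self // => h1.
by rewrite -[LHS]mulr1 -(coef_sqr c0) mulrA -h1 mul1r.
Qed.

End SpanningTrees.

(** * Kirchhoff's theorem and negative correlation for weighted trees *)

Section WeightedTrees.
Context {R : realType} {n : nat} (G : wgraph R n).
Implicit Types (e f g h : edge G) (S T F : {set edge G}) (w : edge G -> R).
Implicit Types x y : 'cV[R]_n.

Definition tree_weight w T : R := if spanning_tree T then \prod_(e in T) w e else 0.

Definition weighted_laplacian w : 'M[R]_n :=
  \sum_e w e *: (incidence e *m (incidence e)^T).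

Local Notation Z w := (up_mass (tree_weight w)).

Lemma incidence_dot e x : (incidence e)^T *m x = (pot_diff (fun v => x v 0) e)%:M.
Proof.
rewrite [LHS]mx11_scalar mxE; congr (_%:M).
under eq_bigr do rewrite !mxE mulrBl.
rewrite sumrB; congr (_ - _).
  rewrite (bigD1 (src e)) //= eqxx mul1r big1 ?addr0 // => v /negPf ->.
  by rewrite mul0r.
rewrite (bigD1 (dst e)) //= eqxx mul1r big1 ?addr0 // => v /negPf ->.
by rewrite mul0r.
Qed.

Lemma weighted_laplacian_mul w x : weighted_laplacian w *m x =
  \sum_e (w e * pot_diff (fun v => x v 0) e) *: incidence e.
Proof.
rewrite mulmx_suml; apply: eq_bigr => e _.
by rewrite -scalemxAl -mulmxA incidence_dot mul_mx_scalar scalerA.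
Qed.

Lemma weighted_laplacian_sym w : (weighted_laplacian w)^T = weighted_laplacian w.
Proof.
rewrite raddf_sum; apply: eq_bigr => e _ /=.
by rewrite linearZ /= trmx_mul trmxK.
Qed.

Lemma weighted_laplacian_psd w : (forall e, 0 <= w e) -> psd (weighted_laplacian w).
Proof.
move=> w0; apply: psd_sum => e _; apply: psdZ => //.
by rewrite -{1}[incidence e]trmxK; exact: psd_gram.
Qed.

Lemma tree_weight_ge0 w T : (forall e, 0 < w e) -> 0 <= tree_weight w T.
Proof.
by move=> w0; rewrite /tree_weight; case: ifP => // _; apply: prodr_ge0 => e _; exact: ltW.
Qed.

Lemma tree_weight_exchange w T e g : (forall e, 0 < w e) ->
  spanning_tree T -> e \in T -> coef T e g != 0 ->
  w g * tree_weight w T = w e * tree_weight w (g |: (T :\ e)).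
Proof.
move=> w0 Tt eT c0; have [St gT _] := exchange Tt eT c0.
rewrite /tree_weight Tt St (big_setD1 e) //= [in RHS](big_setU1 _ gT) /=.
by ring.
Qed.

Lemma exchange_invol T e g : spanning_tree T -> e \in T -> coef T e g != 0 ->
  e |: ((g |: (T :\ e)) :\ g) = T.
Proof.
move=> Tt eT c0; have [_ gT _] := exchange Tt eT c0.
by rewrite finset.setU1K // finset.setD1K.
Qed.

(** Reciprocity. Swapping [e] for [g] is a bijection between the trees contributing to the two
    sides; it keeps the coefficient and multiplies the tree weight by [w g / w e]. *)
Lemma sum_coef_exchange w e g : (forall e, 0 < w e) ->
  w g * \sum_(T : {set edge G} | spanning_tree T && (e \in T)) tree_weight w T * coef T e g =
  w e * \sum_(T : {set edge G} | spanning_tree T && (g \in T)) tree_weight w T * coef T g e.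
Proof.
move=> w0; have coefNZ a b : \sum_(T : {set edge G} | spanning_tree T && (a \in T))
      tree_weight w T * coef T a b =
    \sum_(T : {set edge G} | [&& spanning_tree T, a \in T & coef T a b != 0])
      tree_weight w T * coef T a b.
  rewrite (bigID (fun T => coef T a b != 0)) /= [X in _ + X]big1 ?addr0.
    by apply: eq_bigl => T; rewrite andbA.
  by move=> T /andP[_]; rewrite negbK => /eqP ->; rewrite mulr0.
rewrite !{}coefNZ !mulr_sumr.
have swap T a b : [&& spanning_tree T, a \in T & coef T a b != 0] ->
    [&& spanning_tree (b |: (T :\ a)), b \in b |: (T :\ a) & coef (b |: (T :\ a)) b a != 0].
  move=> /and3P[Tt aT c0]; have [St bT cE] := exchange Tt aT c0.
  by rewrite St setU11 cE.
rewrite [RHS](reindex_onto (fun T => g |: (T :\ e)) (fun T => e |: (T :\ g))) /=; last first.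
  by move=> T /and3P[Tt gT c0]; exact: exchange_invol.
apply: eq_big => T.
  apply/idP/andP => [TP|[/swap + /eqP TE]]; last by rewrite TE.
  by split; [exact: swap|case/and3P: TP => Tt eT c0; rewrite exchange_invol].
move=> /and3P[Tt eT c0]; have [_ _ ->] := exchange Tt eT c0.
by rewrite !mulrA (tree_weight_exchange w0 Tt eT c0).
Qed.

(* The potential of the unit current through [e], as an average over trees. *)
Definition tree_potential w e : 'cV[R]_n :=
  \col_v ((w e * Z w finset.set0)^-1 *
    \sum_(T : {set edge G} | spanning_tree T && (e \in T)) tree_weight w T * side T e v).

Lemma pot_diff_tree_potential w e g :
  pot_diff (fun v => tree_potential w e v 0) g =
  (w e * Z w finset.set0)^-1 *
  \sum_(T : {set edge G} | spanning_tree T && (e \in T)) tree_weight w T * coef T e g.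
Proof.
rewrite /pot_diff !mxE -mulrBr -sumrB; congr (_ * _).
by apply: eq_bigr => T _; rewrite -mulrBr.
Qed.

Lemma up_mass_tree_weight w e : Z w (e |: finset.set0) =
  \sum_(T : {set edge G} | spanning_tree T && (e \in T)) tree_weight w T.
Proof.
rewrite /up_mass (bigID (fun T => spanning_tree T)) /= [X in _ + X]big1 ?addr0.
  by apply: eq_bigl => T; rewrite finset.setU0 finset.sub1set andbC.
by move=> T /andP[_ /negPf]; rewrite /tree_weight => ->.
Qed.

Lemma up_mass0_tree_weight w : Z w finset.set0 =
  \sum_(T : {set edge G} | spanning_tree T) tree_weight w T.
Proof.
rewrite /up_mass (bigID (fun T => spanning_tree T)) /= [X in _ + X]big1 ?addr0.
  by apply: eq_bigl => T; rewrite finset.sub0set.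
by move=> T /andP[_ /negPf]; rewrite /tree_weight => ->.
Qed.

(** Reciprocity rewrites the current through [g] as an average of [coef T g e]. For each tree,
    summing over [g] is the expansion of [incidence e] in that tree. *)
Lemma laplacian_tree_potential w e : (forall e, 0 < w e) -> Z w finset.set0 != 0 ->
  weighted_laplacian w *m tree_potential w e = incidence e.
Proof.
move=> w0 Z0; rewrite weighted_laplacian_mul.
have we0 : w e != 0 by rewrite gt_eqF.
transitivity ((Z w finset.set0)^-1 *: \sum_g \sum_(T : {set edge G} | spanning_tree T && (g \in T))
    (tree_weight w T * coef T g e) *: incidence g).
  rewrite scaler_sumr; apply: eq_bigr => g _.
  rewrite pot_diff_tree_potential mulrCA sum_coef_exchange // invfM.
  by rewrite -scaler_suml scalerA; congr (_ *: _); field; rewrite ?we0 ?Z0.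
rewrite (exchange_big_dep (fun T : {set edge G} => spanning_tree T)) /=; last first.
  by move=> g T _ /andP[].
have -> : \sum_(T : {set edge G} | spanning_tree T)
    \sum_(g | spanning_tree T && (g \in T)) (tree_weight w T * coef T g e) *: incidence g =
    \sum_(T : {set edge G} | spanning_tree T) tree_weight w T *: incidence e.
  apply: eq_bigr => T Tt; rewrite (incidence_expand e Tt) scaler_sumr.
  by apply: eq_big => g; rewrite ?Tt // => _; rewrite scalerA.
by rewrite -scaler_suml -up_mass0_tree_weight scalerA mulVf // scale1r.
Qed.

(** By symmetry of the Laplacian all solutions [x] give the same voltage across [e]. For the tree
    potential it is read off from [coef T e e = 1]. *)
Lemma marginal_potential w e x : (forall e, 0 < w e) -> Z w finset.set0 != 0 ->
  weighted_laplacian w *m x = incidence e ->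
  cond_marginal (tree_weight w) finset.set0 e = w e * ((incidence e)^T *m x) 0 0.
Proof.
move=> w0 Z0 Lx; have we0 : w e != 0 by rewrite gt_eqF.
have -> : (incidence e)^T *m x = (incidence e)^T *m tree_potential w e.
  rewrite -{1}(laplacian_tree_potential e w0 Z0) trmx_mul weighted_laplacian_sym.
  by rewrite -mulmxA Lx -[LHS]trmxK trmx_mul trmxK incidence_dot tr_scalar_mx.
rewrite incidence_dot mxE mulr1n pot_diff_tree_potential.
rewrite /cond_marginal up_mass_tree_weight invfM.
have -> : \sum_(T : {set edge G} | spanning_tree T && (e \in T)) tree_weight w T * coef T e e =
    \sum_(T : {set edge G} | spanning_tree T && (e \in T)) tree_weight w T.
  apply: eq_bigr => T /andP[Tt eT]; rewrite coef_self ?mulr1 //.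
  by have [_] := spanning_treeP _ Tt.
by field; rewrite ?we0 ?Z0.
Qed.

(** With L x = L' x' = b, the nonnegative quantity (x - x')^T L (x - x') + x'^T (L' - L) x' equals
    b^T x - b^T x'. *)
Lemma marginal_rayleigh w w' e : (forall e, 0 < w e) ->
  (forall f, w f <= w' f) -> w' e = w e ->
  Z w finset.set0 != 0 -> Z w' finset.set0 != 0 ->
  cond_marginal (tree_weight w') finset.set0 e <= cond_marginal (tree_weight w) finset.set0 e.
Proof.
move=> w0 ww' we Z0 Z0'; have w0' f : 0 < w' f by exact: lt_le_trans (ww' f).
have Lx := laplacian_tree_potential e w0 Z0.
have Lx' := laplacian_tree_potential e w0' Z0'.
rewrite (marginal_potential w0 Z0 Lx) (marginal_potential w0' Z0' Lx') we.
move: (tree_potential w e) (tree_potential w' e) Lx Lx' => x x' Lx Lx'.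
rewrite ler_pM2l //.
set b := incidence e in Lx Lx' *.
have [_ /(_ (x - x')) L0] := weighted_laplacian_psd (fun f => ltW (w0 f)).
have /(_ x') D0 : forall y,
    0 <= (y^T *m (weighted_laplacian w' - weighted_laplacian w) *m y) 0 0.
  have -> : weighted_laplacian w' - weighted_laplacian w =
      weighted_laplacian (fun f => w' f - w f).
    by rewrite -sumrB; apply: eq_bigr => f _; rewrite scalerBl.
  by apply: (weighted_laplacian_psd _).2 => f; rewrite subr_ge0.
have xL : x^T *m weighted_laplacian w = b^T.
  by rewrite -Lx trmx_mul weighted_laplacian_sym.
have x'b : x'^T *m b = b^T *m x'.
  by rewrite -[LHS]trmxK trmx_mul trmxK incidence_dot tr_scalar_mx.
have D1 (A B : 'M[R]_1) : (A - B) 0 0 = A 0 0 - B 0 0 by rewrite !mxE.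
move: L0 D0; rewrite [(x - x')^T]raddfB /= !mulmxBl !mulmxBr !mulmxBl !D1 xL.
rewrite -!(mulmxA x'^T) Lx Lx' x'b; lra.
Qed.

Lemma tree_weight_scale w f s T :
  tree_weight (fun e => if e == f then s * w e else w e) T =
  tree_weight w T * (if f \in T then s else 1).
Proof.
rewrite /tree_weight; case: ifP => _; last by rewrite mul0r.
case: ifP => fT.
  rewrite (big_setD1 f) //= eqxx [in RHS](big_setD1 f) //=.
  rewrite [X in _ * X = _](eq_bigr w); first by ring.
  by move=> e; rewrite !inE => /andP[/negPf ->].
rewrite mulr1; apply: eq_bigr => e eT; case: eqP => // ef.
by rewrite -ef eT in fT.
Qed.

Lemma up_mass_scale w f s F : 
  Z (fun e => if e == f then s * w e else w e) F = Z w F + (s - 1) * Z w (f |: F).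
Proof.
rewrite up_mass_setU1 mulr_sumr -big_split /=; apply: eq_bigr => T _.
by rewrite tree_weight_scale; case: (f \in T) => /=; ring.
Qed.

(** The algebraic form of letting a weight tend to infinity. If [p > 0], then [u] is taken at least
    1 and so large that [u * p] exceeds [|q| + |r| + 1]. *)
Lemma quadratic_lead_le0 (p q r : R) :
  (forall u, 0 < u -> u ^+ 2 * p + u * q + r <= 0) -> p <= 0.
Proof.
move=> h; rewrite leNgt; apply/negP => p0.
pose u := (`|q| + `|r| + 1) / p + 1.
have u1 : 1 <= u by rewrite lerDr divr_ge0 ?addr_ge0 // ltW.
have := h u (lt_le_trans ltr01 u1).
have up : u * p = `|q| + `|r| + 1 + p by rewrite /u mulrDl divfK ?gt_eqF // mul1r.
have -> : u ^+ 2 * p + u * q + r = u * (`|q| + `|r| + 1 + p) + u * q + r.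
  by rewrite -up; ring.
have := ler_norm (- q); have := ler_norm (- r); rewrite !normrN => hr hq.
have : 0 <= u * (`|q| + q) by rewrite mulr_ge0 //; lra.
have : 0 <= (u - 1) * `|r| by rewrite mulr_ge0 //; lra.
have : 0 < u * (1 + p) by rewrite mulr_gt0 //; lra.
lra.
Qed.

Lemma tree_weight_negcor w F e f : (forall e, 0 < w e) -> e != f ->
  Z w (f |: (e |: F)) * Z w F <= Z w (e |: F) * Z w (f |: F).
Proof.
have [m] := ubnP #|F|; elim: m F w => // m IH F w Fm w0 ef.
have Z_ge0 K : 0 <= Z w K by apply: sumr_ge0 => T _; exact: tree_weight_ge0.
have [F0|[g gF]] := finset.set_0Vmem F.
  rewrite F0; have [Z0|Z0] := eqVneq (Z w finset.set0) 0.
    by rewrite Z0 mulr0 mulr_ge0.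
  (* Doubling the weight of [f] decreases the probability of [e]. *)
  pose w' h := if h == f then 2 * w h else w h.
  have ww' h : w h <= w' h.
    by rewrite /w'; case: eqP => // _; have := w0 h; lra.
  have Z0p : 0 < Z w finset.set0 by rewrite lt0r Z0 Z_ge0.
  have Zf := Z_ge0 (f |: finset.set0).
  have Z'E K : Z w' K = Z w K + Z w (f |: K).
    by rewrite up_mass_scale; ring.
  have Z0' : 0 < Z w' finset.set0 by rewrite Z'E; lra.
  have := marginal_rayleigh w0 ww' _ Z0 (lt0r_neq0 Z0') => /(_ e).
  rewrite {1}/w' (negPf ef) => /(_ erefl).
  rewrite /cond_marginal ler_pdivrMr // mulrAC ler_pdivlMr // !Z'E; lra.
have FE : F = g |: (F :\ g) by rewrite finset.setD1K.
have [eg|eg] := eqVneq e g.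
  have eF : e |: F = F by apply/finset.setUidPr; rewrite finset.sub1set eg.
  by rewrite eF mulrC.
have [fg|fg] := eqVneq f g.
  have fF : f |: F = F by apply/finset.setUidPr; rewrite finset.sub1set fg.
  by rewrite finset.setUCA fF.
(* Scaling the weight of [g] by [s], the inequality for [F :\ g] is a quadratic
   one in [s], whose leading coefficients give the inequality for [F]. *)
have {IH} IH s : 0 < s -> forall w', w' = (fun h => if h == g then s * w h else w h) ->
    Z w' (f |: (e |: (F :\ g))) * Z w' (F :\ g) <=
    Z w' (e |: (F :\ g)) * Z w' (f |: (F :\ g)).
  move=> s0 w' w'E; apply: IH => //.
    by move: Fm; rewrite (cardsD1 g F) gF.
  by move=> h; rewrite w'E; case: ifP => // _; exact: mulr_gt0.
rewrite FE; set K := F :\ g in IH *.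
have -> : f |: (e |: (g |: K)) = g |: (f |: (e |: K)).
  by rewrite (finset.setUCA [set e] [set g]) (finset.setUCA [set f] [set g]).
rewrite (finset.setUCA [set e] [set g]) (finset.setUCA [set f] [set g]).
have {}IH s : 0 < s -> _ := fun s0 => IH s s0 _ erefl.
set a1 := Z w (f |: (e |: K)) in IH *; set b1 := Z w (g |: (f |: (e |: K))) in IH *.
set a2 := Z w K in IH *; set b2 := Z w (g |: K) in IH *.
set a3 := Z w (e |: K) in IH *; set b3 := Z w (g |: (e |: K)) in IH *.
set a4 := Z w (f |: K) in IH *; set b4 := Z w (g |: (f |: K)) in IH *.
(* With [s = u + 1] every mass is [a + u b], so the leading coefficient is [b1 * b2 - b3 * b4]. *)
rewrite -subr_le0; apply: (@quadratic_lead_le0 _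
  (a1 * b2 + b1 * a2 - a3 * b4 - b3 * a4) (a1 * a2 - a3 * a4)) => u u0.
have s0 : 0 < u + 1 by lra.
have := IH _ s0; rewrite !up_mass_scale addrK -subr_le0.
rewrite -/a1 -/b1 -/a2 -/b2 -/a3 -/b3 -/a4 -/b4.
move=> h; apply: le_trans h; rewrite le_eqVlt; apply/orP; left; apply/eqP; ring.
Qed.

End WeightedTrees.

(** * Independent trees *)

Section IndependentSums.
Context {R : realType} {A : finType} {n : nat}.

Lemma sum_ffun_recl (V : nmodType) t (F : {ffun 'I_t.+1 -> A} -> V) :
  \sum_f F f = \sum_a \sum_(f : {ffun 'I_t -> A})
    F [ffun i => oapp f a (unlift ord0 i)].
Proof.
rewrite pair_big /=.
rewrite (reindex (fun p : A * {ffun 'I_t -> A} =>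
  [ffun i => oapp p.2 p.1 (unlift ord0 i)])) //=.
exists (fun f => (f ord0, [ffun i => f (lift ord0 i)])) => [[a f] _|f _] /=.
  rewrite ffunE unlift_none; congr (_, _).
  by apply/ffunP => i; rewrite !ffunE liftK.
by apply/ffunP => i; rewrite ffunE /=; case: unliftP => [j ->|->] /=; rewrite ?ffunE.
Qed.

(** One summand is added at a time; the one-step bound holds for every [K], so the summands already
    present are absorbed into it. *)
Lemma trexp_independent_sum (m : A -> R) (Y : A -> 'M[R]_n) (Pi : 'M[R]_n) (C : R) t H :
  (forall a, 0 <= m a) -> 0 <= C ->
  (forall a, (Y a)^T = Y a) -> (forall a, Pi * Y a = Y a) ->
  (forall K, K^T = K -> Pi * K = K ->
    asymp_le (fun j => \sum_a m a * trexp Pi j (K + Y a)) (fun j => C * trexp Pi j K)) ->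
  H^T = H -> Pi * H = H ->
  asymp_le (fun j => \sum_(f : {ffun 'I_t -> A})
              (\prod_i m (f i)) * trexp Pi j (H + \sum_i Y (f i)))
           (fun j => C ^+ t * trexp Pi j H).
Proof.
move=> m0 C0 Ys PY step; elim: t H => [|t IH] H Hs PH.
  apply: asymp_le_of => j; rewrite (big_pred1 [ffun i : 'I_0 => False_rect A (notF (ltn_ord i))]).
    by rewrite !big_ord0 addr0.
  by move=> f /=; apply/esym/eqP/ffunP => -[].
have h1 : asymp_le
   (fun j => \sum_a m a * (\sum_(f : {ffun 'I_t -> A})
              (\prod_i m (f i)) * trexp Pi j (H + Y a + \sum_i Y (f i))))
   (fun j => \sum_a m a * (C ^+ t * trexp Pi j (H + Y a))).
  apply: asymp_le_sum => a _; apply: asymp_leZ; first exact: m0.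
  by apply: IH; rewrite ?raddfD /= ?mulrDr ?Hs ?Ys ?PH ?PY.
have h2 := asymp_leZ (exprn_ge0 t C0) (step H Hs PH).
apply: (asymp_le_trans (asymp_le_of _)
  (asymp_le_trans h1 (asymp_le_trans (asymp_le_of _) (asymp_le_trans h2 (asymp_le_of _))))) => j.
- rewrite sum_ffun_recl; apply: ler_sum => a _; rewrite mulr_sumr; apply: ler_sum => f _.
  rewrite !big_ord_recl !ffunE unlift_none /= addrA mulrA.
  under eq_bigr do rewrite ffunE liftK /=.
  by under [X in _ + X]eq_bigr do rewrite ffunE liftK /=.
- by rewrite mulr_sumr; apply: ler_sum => a _; rewrite mulrCA.
- by rewrite mulrA exprSr.
Qed.

End IndependentSums.

(** * Spanning trees as sums of rank-one projections *)

Section EdgeSpace.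
Context {R : realType} {n : nat} (G : wgraph R n).
Implicit Types (e f : edge G) (T : {set edge G}) (x : 'cV[R]_n).

Local Notation L := (laplacian G).
Local Notation X := (mp_pinv L).
Local Notation mu := (tree_weight (@weight _ _ G)).
Local Notation b := (@incidence _ _ G).

Lemma laplacian_factor : exists p, exists S : 'M[R]_(p, n), S^T *m S = L.
Proof.
exists #|edge G|.
exists (\matrix_(i, j) (Num.sqrt (weight (enum_val i : edge G)) * b (enum_val i) j 0)).
apply/matrixP => u v; rewrite !mxE summxE.
rewrite [RHS](reindex (@enum_val (edge G) xpredT)) /=; last exact/onW_bij/enum_val_bij.
apply: eq_bigr => i _; rewrite !mxE big_ord1 !mxE.
rewrite mulrACA -expr2 sqr_sqrtr ?ltW ?weight_gt0 //.
Qed.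

Lemma laplacian_sym : L^T = L.
Proof. exact: (weighted_laplacian_sym (@weight _ _ G)). Qed.

Lemma mp_pinv_sym (A : 'M[R]_n) : A^T = A -> (mp_pinv A)^T = mp_pinv A.
Proof.
move=> As; apply/esym/mp_pinv_unique; have := mp_pinvP A.
move: (mp_pinv A) => Y [AYA YAY AYs YAs].
have AYt : A *m Y^T = Y *m A by rewrite -YAs trmx_mul As.
have YtA : Y^T *m A = A *m Y by rewrite -AYs trmx_mul As.
have AE : A = (A *m Y *m A)^T by rewrite AYA As.
have YE : Y^T = (Y *m A *m Y)^T by rewrite YAY.
split.
- by rewrite [RHS]AE !trmx_mul As mulmxA.
- by rewrite [RHS]YE !trmx_mul As mulmxA.
- by rewrite AYt YAs.
- by rewrite YtA AYs.
Qed.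

Hypothesis Z0 : up_mass mu finset.set0 != 0.

Let w0 e : 0 < weight e. Proof. exact: weight_gt0. Qed.
Let Lx e : L *m tree_potential (@weight _ _ G) e = b e.
Proof. exact: laplacian_tree_potential. Qed.

(** For L x = b the pseudoinverse gives b^T L^+ b = x^T L L^+ L x = x^T b, the voltage across
    [e]. *)
Lemma leverage_marginal e : cond_marginal mu finset.set0 e = leverage e.
Proof.
rewrite (marginal_potential w0 Z0 (Lx e)) /leverage; congr (_ * _).
have [LXL _ _ _] := mp_pinvP L.
have -> : (b e)^T *m X *m b e = (tree_potential (@weight _ _ G) e)^T *m b e.
  rewrite -[in LHS](Lx e) trmx_mul laplacian_sym -!mulmxA (mulmxA L X).
  by rewrite (mulmxA _ L) LXL -[in RHS](Lx e).
by rewrite -[_^T *m b e]trmxK trmx_mul trmxK incidence_dot tr_scalar_mx.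
Qed.

Lemma pinv_laplacian_incidence e : (b e)^T *m X *m L = (b e)^T.
Proof.
have [LXL _ _ _] := mp_pinvP L.
by rewrite -(Lx e) trmx_mul laplacian_sym -!mulmxA (mulmxA L X) LXL.
Qed.

Variables (p : nat) (S : 'M[R]_(p, n)).
Hypothesis SS : S^T *m S = L.

(** Stands for the square root of L^+ applied to sqrt(w_e) b_e, without taking a matrix square root;
    its squared length is the leverage score. *)
Definition edge_vector e : 'cV[R]_p :=
  Num.sqrt (weight e) *: (S *m X *m b e).

(* A leverage score 0 is harmless here: [edge_vector e] is then 0 as well. *)
Definition edge_proj e : 'M[R]_p :=
  (leverage e)^-1 *: (edge_vector e *m (edge_vector e)^T).

Local Notation z := edge_vector.
Local Notation A := edge_proj.
Local Notation Pi := (cond_mean mu edge_proj finset.set0).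

Let trmxZ m q a (M : 'M[R]_(m, q)) : (a *: M)^T = a *: M^T.
Proof. by rewrite linearZ. Qed.

Let Xs : X^T = X. Proof. by apply: mp_pinv_sym; exact: laplacian_sym. Qed.

Lemma edge_vector_dot e : ((z e)^T *m z e) 0 0 = leverage e.
Proof.
have [LXL XLX _ _] := mp_pinvP L.
rewrite /edge_vector trmxZ -scalemxAl -scalemxAr scalerA -expr2.
rewrite sqr_sqrtr ?ltW ?w0 // mxE; congr (_ * _).
rewrite !trmx_mul Xs !mulmxA -(mulmxA _ S^T) SS -(mulmxA _ X L) -(mulmxA _ (X *m L)).
by rewrite XLX.
Qed.

Lemma edge_proj_psd e : psd (A e).
Proof.
apply: psdZ; last by rewrite -{1}[z e]trmxK; exact: psd_gram.
by rewrite invr_ge0 -edge_vector_dot dot_ge0.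
Qed.

Lemma edge_proj_le1 e : psd (1 - A e).
Proof.
have := psd_cauchy_schwarz (z e); rewrite edge_vector_dot /edge_proj.
have l0 : 0 <= leverage e by rewrite -edge_vector_dot dot_ge0.
have [-> _|lN] := eqVneq (leverage e) 0.
  by rewrite invr0 scale0r subr0; exact: psd1.
move=> /(psdZ (_ : 0 <= (leverage e)^-1)); rewrite invr_ge0 => /(_ l0).
by rewrite scalerBr scalerA mulVf // scale1r.
Qed.

(** The marginal of [e] is its leverage score, which cancels the normalisation of [edge_proj]; the
    sum left over is that of the Laplacian. If the score is 0, the edge vector vanishes as well. *)
Lemma mean_edge_proj : Pi = S *m X *m S^T.
Proof.
have [LXL XLX _ _] := mp_pinvP L.
have -> : Pi = \sum_e z e *m (z e)^T.
  apply: eq_bigr => e _; rewrite leverage_marginal /edge_proj scalerA.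
  have [l0|lN] := eqVneq (leverage e) 0; last by rewrite mulfV // scale1r.
  suff -> : z e = 0 by rewrite mul0mx scaler0.
  apply/matrixP => i j; rewrite ord1 [RHS]mxE.
  have : ((z e)^T *m z e) 0 0 = 0 by rewrite edge_vector_dot.
  rewrite mxE; under eq_bigr do rewrite mxE -expr2.
  move/eqP; rewrite psumr_eq0; last by move=> *; exact: sqr_ge0.
  by move=> /allP/(_ i (mem_index_enum _)); rewrite sqrf_eq0 => /eqP.
transitivity (S *m X *m L *m X *m S^T); last by rewrite -!mulmxA (mulmxA X) (mulmxA _ X) XLX.
rewrite [in RHS]/(laplacian G) mulmx_sumr !mulmx_suml; apply: eq_bigr => e _.
rewrite /edge_vector trmxZ -scalemxAl -!scalemxAr scalerA -expr2.
rewrite sqr_sqrtr ?ltW ?w0 // -!scalemxAl; congr (_ *: _).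
by rewrite !trmx_mul Xs !mulmxA.
Qed.

Lemma proj_edge_vector e : Pi *m z e = z e.
Proof.
have [LXL XLX _ _] := mp_pinvP L.
rewrite mean_edge_proj /edge_vector -scalemxAr; congr (_ *: _).
rewrite !mulmxA -(mulmxA _ S^T) SS -(mulmxA S X) -(mulmxA S (X *m L)).
by rewrite XLX.
Qed.

Lemma proj_edge_proj e : Pi * A e = A e.
Proof. by rewrite /edge_proj scalemxMr -mulmxE mulmxA proj_edge_vector. Qed.

Lemma mean_edge_proj_idem : Pi * Pi = Pi.
Proof. exact: (proj_cond_mean proj_edge_proj). Qed.

Lemma mean_edge_proj_sym : Pi^T = Pi.
Proof. exact: (cond_mean_sym mu edge_proj_psd). Qed.

(** The test vector that carries the quadratic forms of [laplacian G] and [tree_laplacian] at [x]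
    over to the edge space. *)
Definition edge_image x : 'cV[R]_p := Pi *m (S *m x).

Lemma proj_edge_image x : Pi *m edge_image x = edge_image x.
Proof. by rewrite /edge_image mulmxA [Pi *m Pi]mean_edge_proj_idem. Qed.

Lemma edge_image_dot x : (edge_image x)^T *m edge_image x = x^T *m L *m x.
Proof.
have [LXL XLX _ _] := mp_pinvP L.
rewrite /edge_image trmx_mul mean_edge_proj_sym -!mulmxA (mulmxA Pi Pi).
rewrite [Pi *m Pi]mean_edge_proj_idem mean_edge_proj trmx_mul.
rewrite -!mulmxA (mulmxA S^T S) SS (mulmxA S^T S) SS.
by rewrite (mulmxA L X) (mulmxA _ L) LXL.
Qed.

Lemma edge_vector_image e x : (z e)^T *m edge_image x =
  Num.sqrt (weight e) *: ((b e)^T *m x).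
Proof.
rewrite /edge_image mulmxA -mean_edge_proj_sym -trmx_mul proj_edge_vector.
rewrite /edge_vector trmxZ -scalemxAl; congr (_ *: _).
by rewrite !trmx_mul Xs -!mulmxA (mulmxA S^T) SS !mulmxA pinv_laplacian_incidence.
Qed.

Lemma edge_proj_image T x :
  ((edge_image x)^T *m (\sum_(e in T) A e) *m edge_image x) 0 0 =
  (x^T *m tree_laplacian T *m x) 0 0.
Proof.
rewrite /tree_laplacian !mulmx_sumr !mulmx_suml !summxE; apply: eq_bigr => e _.
have := edge_vector_image e x; rewrite /edge_proj.
move: (z e) (edge_image x) => v y vy.
rewrite -!scalemxAr -!scalemxAl [LHS]mxE [RHS]mxE.
rewrite [weight e / _]mulrC -mulrA; congr (_ * _).
have -> : y^T *m (v *m v^T) *m y = (v^T *m y)^T *m (v^T *m y).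
  by rewrite trmx_mul trmxK !mulmxA.
rewrite vy trmxZ -scalemxAl -scalemxAr scalerA -expr2.
rewrite sqr_sqrtr ?ltW ?w0 // mxE; congr (_ * _).
by rewrite trmx_mul trmxK !mulmxA.
Qed.

(** Cyclicity moves the trace to [X *m L], a symmetric idempotent on the vertex space. *)
Lemma mxtrace_mean_edge_proj : \tr Pi <= n%:R.
Proof.
have [LXL XLX _ XLs] := mp_pinvP L.
rewrite mean_edge_proj -mulmxA mxtrace_mulC -mulmxA SS.
have : 0 <= \tr (1 - X *m L).
  apply: psd_trace_ge0; have := psd_gram (1 - X *m L).
  have -> : (1 - X *m L)^T = 1 - X *m L by rewrite raddfB /= trmx1 XLs.
  rewrite mulmxE mulrBl mul1r mulrBr mulr1.
  have -> : (X *m L : 'M[R]_n) * (X *m L) = X *m L by rewrite -mulmxE !mulmxA XLX.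
  by rewrite subrr subr0.
by rewrite raddfB /= mxtrace1 subr_ge0.
Qed.

End EdgeSpace.

(** * The logarithmic factor *)

Section HarmonicSums.
Context {R : realType}.

Lemma harmonic_le_ln n : \sum_(i < n.+1) i.+1%:R^-1 <= 1 + ln n.+1%:R :> R.
Proof.
elim: n => [|n IH]; first by rewrite big_ord_recl big_ord0 invr1 ln1.
rewrite big_ord_recr /=.
have : n.+2%:R^-1 <= ln n.+2%:R - ln n.+1%:R :> R; last first.
  by move=> /(lerD IH)/le_trans; apply; rewrite addrCA addrK addrC.
rewrite -ln_div ?posrE // -[leLHS]opprK -[leRHS]opprK lerN2.
rewrite -lnV ?posrE ?divr_gt0 // invf_div.
have -> : n.+1%:R / n.+2%:R = 1 + - n.+2%:R^-1 :> R.
  have n2 : n.+2%:R != 0 :> R by rewrite pnatr_eq0.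
  by apply: (mulIf n2); rewrite mulfVK // mulrDl mul1r mulNr mulVf // -(natr1 n.+1) addrK.
by apply: le_ln1Dx; rewrite ltrN2 invf_lt1 ?ltr1n.
Qed.

Lemma prod_harmonic_le (a : R) k n : 0 <= a -> (k <= n)%N -> (0 < n)%N ->
  \prod_(i < k) (1 + a / i.+1%:R) <= expR (a * (1 + ln n%:R)).
Proof.
move=> a0 kn n0.
apply: (@le_trans _ _ (expR (\sum_(i < k) a / i.+1%:R))).
  rewrite expR_sum; apply: ler_prod => i _.
  by rewrite expR_ge1Dx addr_ge0 // divr_ge0.
rewrite ler_expR -mulr_sumr ler_wpM2l //.
case: n n0 kn => // n _ kn; apply: le_trans (harmonic_le_ln n).
rewrite (big_ord_widen _ (fun i => i.+1%:R^-1) kn) big_mkcond /=.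
by apply: ler_sum => i _; case: ifP => // _; rewrite invr_ge0.
Qed.

End HarmonicSums.

(** * The tail bound for a tuple of trees *)

Section TreeTupleTail.
Context {R : realType} {n : nat} (G : wgraph R n).
Implicit Types (T : {set edge G}) (x : 'cV[R]_n).

Local Notation L := (laplacian G).
Local Notation mu := (tree_weight (@weight _ _ G)).
Local Notation Z := (up_mass mu finset.set0).

Hypothesis n_gt0 : (0 < n)%N.

Lemma tree_probE T : tree_prob T = mu T / Z.
Proof.
rewrite /tree_prob up_mass0_tree_weight /tree_weight; case: ifP => _; last by rewrite mul0r.
by congr (_ / _); apply: eq_bigr => S ->.
Qed.

Lemma tree_prob_ge0 T : 0 <= tree_prob T.
Proof.
rewrite tree_probE divr_ge0 ?tree_weight_ge0 //; try exact: weight_gt0.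
by apply: up_mass_ge0 => S; apply: tree_weight_ge0; exact: weight_gt0.
Qed.

Hypothesis Z0 : Z != 0.

(** The sign of [theta] selects the upper or the lower deviation, so that one tail bound serves
    both. *)
Definition deviates t (theta delta : R) (f : {ffun 'I_t -> {set edge G}}) : bool :=
  `[< exists x, delta * (x^T *m L *m x) 0 0 <
      theta * ((x^T *m (\sum_i tree_laplacian (f i)) *m x) 0 0 -
               t%:R * (x^T *m L *m x) 0 0) >].

(** Markov's inequality for the trace exponential. The summand 1 absorbs the discretisation error,
    and [delta / 2] comes from bounding compound interest below. *)
Lemma tree_tuple_tail t (theta delta : R) : `|theta| <= 1 -> 0 <= delta ->
  \sum_(f | deviates (t := t) theta delta f) \prod_i tree_prob (f i) <=
  (n%:R * expR (8 * theta ^+ 2 * (1 + ln n%:R) * t%:R) + 1) * expR (- (delta / 2)).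
Proof.
move=> th d0.
have w0 e : 0 < weight (e : edge G) by exact: weight_gt0.
have mu0 T : 0 <= mu T by exact: tree_weight_ge0.
have Zp : 0 < Z by rewrite lt0r Z0 up_mass_ge0.
have [T0 tT0] : exists T0 : {set edge G}, spanning_tree T0.
  apply/existsP; apply: contra_neqT Z0; rewrite negb_exists => /forallP nT.
  by rewrite up_mass0_tree_weight big_pred0 // => T; exact/negbTE.
have [k kE] : exists k, k = #|T0| by eexists.
have mu_card T : mu T != 0 -> #|T| = k.
  rewrite /tree_weight; case: ifP => [tT _|]; last by rewrite eqxx.
  by rewrite kE; exact: spanning_tree_card.
have [p [S SS]] := laplacian_factor G.
pose A : edge G -> 'M[R]_p := @edge_proj _ _ G _ S; pose Pi := cond_mean mu A finset.set0.
have Apsd := edge_proj_psd SS; have Ale1 := edge_proj_le1 SS.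
have PA := proj_edge_proj Z0 SS.
have Pis : Pi^T = Pi := mean_edge_proj_sym SS.
have PP : Pi * Pi = Pi := mean_edge_proj_idem Z0 SS.
have Ppsd : psd Pi by have := psd_sqr Pis; rewrite expr2 PP.
(* The tree size is the sum of the marginals, which the trace of [Pi] dominates: [edge_proj e] has
   trace 1 unless the marginal is 0. *)
have kn : (k <= n)%N.
  rewrite -(ler_nat R); apply: le_trans (mxtrace_mean_edge_proj Z0 SS).
  rewrite -(sum_cond_marginal mu_card Z0) raddf_sum /=; apply: ler_sum => e _.
  rewrite mxtraceZ /edge_proj mxtraceZ mxtrace_mulC /mxtrace big_ord1.
  rewrite (edge_vector_dot SS) (leverage_marginal Z0).
  have [->|l0] := eqVneq (leverage e) 0; first by rewrite mul0r.
  by rewrite mulVf // mulr1.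
pose c : R := \prod_(i < k) (1 + 8 * theta ^+ 2 / i.+1%:R).
have c0 : 0 <= c.
  by apply: prodr_ge0 => i _; rewrite addr_ge0 // divr_ge0 // mulr_ge0 // sqr_ge0.
have cle : c <= expR (8 * theta ^+ 2 * (1 + ln n%:R)).
  by apply: prod_harmonic_le => //; rewrite mulr_ge0 // sqr_ge0.
pose Y T : 'M[R]_p := theta *: (\sum_(e in T) A e - Pi).
have As e : (A e)^T = A e by have [] := Apsd e.
have Ys T : (Y T)^T = Y T.
  rewrite /Y linearZ /= raddfB /= Pis raddf_sum /=.
  by congr (_ *: (_ - _)); apply: eq_bigr => e _.
have PY T : Pi * Y T = Y T.
  rewrite /Y scalemxMr mulrBr PP mulr_sumr.
  by congr (_ *: (_ - _)); apply: eq_bigr => e _; exact: PA.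
have step K : K^T = K -> Pi * K = K ->
    asymp_le (fun j => \sum_T mu T * trexp Pi j (K + Y T))
             (fun j => (c * Z) * trexp Pi j K).
  move=> Ks PK.
  have negcor F e f : e != f -> up_mass mu (f |: (e |: F)) * up_mass mu F <=
      up_mass mu (e |: F) * up_mass mu (f |: F) by exact: tree_weight_negcor.
  (* Starting from [K - theta *: Pi] centres the sum, because the martingale begins at [Pi]. *)
  have := revelation_process mu0 mu_card negcor Apsd Ale1 PA finset.set0 (H := K - theta *: Pi) th.
  rewrite raddfB /= linearZ /= Ks Pis mulrBr PK scalemxMr PP => /(_ erefl erefl).
  move=> main; apply: (asymp_le_trans (asymp_le_of _) (asymp_le_trans main (asymp_le_of _))) => j.
    rewrite [leRHS](eq_bigl xpredT); last by move=> T; rewrite finset.sub0set.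
    apply: ler_sum => T _; rewrite /Y scalerBr.
    by rewrite [K + (_ - _)]addrA addrAC.
  by rewrite finset.cards0 subn0 -/c subrK mulrA.
have [K main] := trexp_independent_sum t mu0 (mulr_ge0 c0 (ltW Zp)) Ys PY step
  (trmx0 _ _ _) (mulr0 Pi).
have tr0 j : trexp Pi j 0 <= n%:R.
  rewrite /trexp /mexp scaler0 addr0 expr1n mulr1.
  exact: mxtrace_mean_edge_proj.
have large j (f : {ffun 'I_t -> {set edge G}}) : delta <= (2 ^ j.+1)%:R ->
    deviates theta delta f -> expR (delta / 2) <= trexp Pi j (0 + \sum_i Y (f i)).
  move=> dj /asboolP[x xdev]; rewrite add0r.
  have [N NE] : exists N, (2 ^ j.+1)%N = N.+1.
    by exists (2 ^ j.+1).-1; rewrite prednK ?expn_gt0.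
  apply: (@le_trans _ _ ((1 + (2 ^ j.+1)%:R^-1 * delta) ^+ (2 ^ j.+1))).
    by rewrite NE in dj *; exact: expR_half_le_compound_interest.
  have Py := proj_edge_image Z0 SS x; have yy := edge_image_dot Z0 SS x.
  have yA T := edge_proj_image Z0 SS T x.
  move: (edge_image G S x) Py yy yA => y Py yy yA.
  apply: (trexp_ge _ Pis PP _ _ Py d0).
  - by rewrite mulr_sumr; apply: eq_bigr => i _; exact: PY.
  - by rewrite raddf_sum; apply: eq_bigr => i _; exact: Ys.
  rewrite yy; apply: (lt_le_trans xdev).
  have yYy T : (y^T *m Y T *m y) 0 0 =
      theta * ((x^T *m tree_laplacian T *m x) 0 0 - (x^T *m L *m x) 0 0).
    rewrite /Y -scalemxAr -scalemxAl mxE mulmxBr mulmxBl.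
    rewrite -[y^T *m Pi *m y]mulmxA Py yy -yA.
    by congr (_ * _); rewrite !mxE.
  move: ((x^T *m L *m x) 0 0) yYy => q yYy.
  rewrite !mulmx_sumr !mulmx_suml !summxE.
  under [leRHS]eq_bigr do rewrite yYy.
  by rewrite -mulr_sumr sumrB sumr_const card_ord mulr_natl.
(* The discretisation is fixed here: fine enough for the lower bound at [delta] and for an
   accumulated error of at most 1. *)
have [j [dj Kj]] : exists j, delta <= (2 ^ j.+1)%:R /\ K / Z ^+ t / (2 ^ j)%:R <= 1.
  pose j := maxn (Num.bound `|delta|) (Num.bound `|K / Z ^+ t|).
  have bound_le (a : R) : (Num.bound `|a| <= j)%N -> a <= (2 ^ j)%:R.
    move=> aj; apply: le_trans (ler_norm a) (ltW (lt_le_trans (archi_boundP (normr_ge0 a)) _)).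
    by rewrite ler_nat (leq_trans aj) // ltnW // ltn_expl.
  exists j; split.
    apply: le_trans (bound_le _ (leq_maxl _ _)) _.
    by rewrite ler_nat leq_pexp2l.
  by rewrite ler_pdivrMr ?ltr0n ?expn_gt0 // mul1r bound_le ?leq_maxr.
rewrite expRN ler_pdivlMr ?expR_gt0 // mulr_suml.
apply: (@le_trans _ _ (\sum_(f : {ffun 'I_t -> {set edge G}})
    (\prod_i tree_prob (f i)) * trexp Pi j (0 + \sum_i Y (f i)))).
  rewrite [leRHS](bigID (deviates theta delta)) /= -[leLHS]addr0 lerD //.
    apply: ler_sum => f fdev; rewrite ler_wpM2l ?large //.
    by apply: prodr_ge0 => i _; exact: tree_prob_ge0.
  apply: sumr_ge0 => f _; rewrite mulr_ge0 ?prodr_ge0 // => [i _|].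
    exact: tree_prob_ge0.
  apply: trexp_ge0 => //; rewrite add0r raddf_sum.
  by apply: eq_bigr => i _; exact: Ys.
have prodE (f : {ffun 'I_t -> {set edge G}}) :
    \prod_i tree_prob (f i) = (Z ^+ t)^-1 * \prod_i mu (f i).
  under eq_bigr do rewrite tree_probE mulrC.
  by rewrite big_split /= prodr_const card_ord exprVn.
under eq_bigr do rewrite prodE -mulrA.
rewrite -mulr_sumr; have Zt : 0 < Z ^+ t by exact: exprn_gt0.
apply: le_trans (ler_wpM2l _ (main j)) _; first by rewrite invr_ge0 ltW.
rewrite mulrDr lerD //; last by rewrite mulrA [_^-1 * K]mulrC.
rewrite exprMn mulrA [c ^+ t * _]mulrC mulKf ?gt_eqF // mulrC ler_pM //.
- exact: trexp_ge0 (trmx0 _ _ _).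
- exact: exprn_ge0.
by rewrite expRM_natr lerXn2r // nnegrE expR_ge0.
Qed.

End TreeTupleTail.

(** * From independent random variables to sums over tuples *)

Section TupleProbability.
Context {d : measure_display} {Omega : measurableType d} {R : realType}.
Variable P : probability Omega R.

(** The event is the disjoint union of the finitely many atoms [B f], and independence over the full
    index set gives each of them a product mass. *)
Lemma probability_tuple (A : finType) (t : nat) (X : 'I_t -> Omega -> A) (m : A -> R)
    (D : pred {ffun 'I_t -> A}) :
  (forall i, finite_rv (X i)) ->
  (forall i a, P (X i @^-1` [set a]) = (m a)%:E) ->
  mutually_independent P X ->
  P [set w | D [ffun i => X i w]] = (\sum_(f | D f) \prod_i m (f i))%:E.
Proof.
move=> Xm Xlaw Xind.
pose B (f : {ffun 'I_t -> A}) : set Omega :=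
  \bigcap_(i in [set` [set: 'I_t]%SET]) (X i @^-1` [set f i]).
have mB f : measurable (B f).
  by apply: fin_bigcap_measurable => // i _; exact: Xm.
have PB f : P (B f) = (\prod_i m (f i))%:E.
  rewrite Xind [LHS](eq_bigl xpredT); last by move=> i; exact: finset.in_setT.
  under eq_bigr do rewrite Xlaw.
  by elim/big_ind2 : _ => // x1 x2 y1 y2 -> ->.
have -> : [set w | D [ffun i => X i w]] = \bigcup_(f in [set` D]) B f.
  apply/seteqP; split => [w /= Dw|w [f /= Df Bw]].
    by exists [ffun i => X i w] => //= i _ /=; rewrite ffunE.
  have -> : [ffun i => X i w] = f.
    by apply/ffunP => i; rewrite ffunE; apply: Bw => /=; exact: finset.in_setT.
  exact: Df.
rewrite measure_fin_bigcup //.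
- have -> : [set` D] = [set` enum D] by apply/seteqP; split=> f /=; rewrite mem_enum.
  rewrite -fsbig_seq ?enum_uniq // big_enum /=.
  under eq_bigr do rewrite PB.
  by elim/big_ind2 : _ => // x1 x2 y1 y2 -> ->.
- move=> f g _ _ [w [fw gw]]; apply/ffunP => i.
  by rewrite -(fw i (finset.in_setT i)) -(gw i (finset.in_setT i)).
Qed.

End TupleProbability.

(** * Choice of the parameters and conclusion *)

Lemma exponent_choice (R : realType) (h l eps t s : R) :
  0 < l -> 1 <= h -> h <= 3 * l -> 0 < eps -> 1 <= t -> 384 <= s ->
  s ^+ 2 * l ^+ 2 <= eps ^+ 2 * t ->
  exists theta, [/\ 0 < theta, theta <= 1 &
    8 * theta ^+ 2 * h * t - theta * eps * t / 2 <= - (s / 384 * l)].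
Proof.
move=> l0 h1 hl e0 t1 s1 stl.
have h0 : 0 < h by lra.
(* The value [eps / (32 * h)] minimises the quadratic in [theta], with minimum
   [- eps^2 t / (128 h)]; 384 is 128 times the 3 of [h <= 3 * l]. When it exceeds 1, [theta] is
   capped at 1. *)
have [eh|eh] := leP eps (32 * h).
  exists (eps / (32 * h)); split; first by rewrite divr_gt0 // mulr_gt0.
    by rewrite ler_pdivrMr ?mulr_gt0 // mul1r.
  have -> : 8 * (eps / (32 * h)) ^+ 2 * h * t - eps / (32 * h) * eps * t / 2 =
      - (eps ^+ 2 * t / (128 * h)) by field; rewrite gt_eqF.
  rewrite lerN2 ler_pdivlMr ?mulr_gt0 //; apply: le_trans stl.
  have -> : s / 384 * l * (128 * h) = s * l * (h / 3) by field.
  have -> : s ^+ 2 * l ^+ 2 = s * l * (s * l) by ring.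
  rewrite ler_wpM2l ?mulr_ge0 //; [lra|lra|].
  have : 0 <= (s - 1) * l by rewrite mulr_ge0; lra.
  lra.
exists 1; split => //.
have et0 : 0 < eps * t by rewrite mulr_gt0 //; lra.
have sl0 : 0 <= s * l by rewrite mulr_ge0; lra.
have slet : s * l <= eps * t.
  rewrite -(@ler_pXn2r _ 2) ?nnegrE ?(ltW et0) // !exprMn; apply: le_trans stl _.
  rewrite [t ^+ 2]expr2 mulrA ler_peMr // mulr_ge0 ?sqr_ge0 //; lra.
have ht : 8 * h * t <= eps * t / 4.
  have -> : eps * t / 4 = eps / 4 * t by ring.
  by rewrite ler_wpM2r; lra.
have -> : s / 384 * l = s * l / 384 by ring.
rewrite expr1n mulr1 mul1r; lra.
Qed.

(** It suffices that ln 2 is at least 1/2, which is ln(1 - x) <= -x at x = 1/2. *)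
Lemma one_add_ln_le (R : realType) (n : nat) : (2 <= n)%N ->
  [/\ 0 < ln n%:R :> R & 1 + ln n%:R <= 3 * ln n%:R :> R].
Proof.
move=> n2; have h : 2^-1 <= ln 2 :> R.
  have : ln (1 + - 2^-1) <= - 2^-1 :> R by apply: le_ln1Dx; lra.
  have -> : 1 + - 2^-1 = 2^-1 :> R by field.
  by rewrite lnV ?posrE // lerN2.
have : ln 2 <= ln n%:R :> R by rewrite ler_ln ?posrE ?ltr0n ?(ltn_trans _ n2) // ler_nat.
split; lra.
Qed.

Lemma loewner_of_not_deviates (R : realType) (n : nat) (G : wgraph R n) (eps theta : R) t
    (f : {ffun 'I_t -> {set edge G}}) : (0 < t)%N -> 0 < theta ->
  ~~ deviates theta (theta * eps * t%:R) f ->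
  ~~ deviates (- theta) (theta * eps * t%:R) f ->
  let L := t%:R^-1 *: (\sum_(i < t) tree_laplacian (f i)) in
  loewner_le ((1 - eps) *: laplacian G) L /\ loewner_le L ((1 + eps) *: laplacian G).
Proof.
move=> t0 th0 /asboolPn up /asboolPn low L.
have tR : 0 < t%:R :> R by rewrite ltr0n.
have Ls : L^T = L.
  rewrite /L linearZ /= raddf_sum; congr (_ *: _); apply: eq_bigr => i _ /=.
  rewrite raddf_sum; apply: eq_bigr => e _ /=.
  by rewrite linearZ /= trmx_mul trmxK.
have key (x : 'cV[R]_n) : `|(x^T *m (\sum_i tree_laplacian (f i)) *m x) 0 0 -
     t%:R * (x^T *m laplacian G *m x) 0 0| <= eps * t%:R * (x^T *m laplacian G *m x) 0 0.
  rewrite ler_norml -(ler_pM2l th0) -[X in _ && X](ler_pM2l th0).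
  apply/andP; split; rewrite leNgt; apply/negP => h.
    by apply: low; exists x; lra.
  by apply: up; exists x; lra.
have qL (x : 'cV[R]_n) : (x^T *m L *m x) 0 0 =
    t%:R^-1 * (x^T *m (\sum_i tree_laplacian (f i)) *m x) 0 0.
  by rewrite /L -scalemxAr -scalemxAl mxE.
have D1 (A B : 'M[R]_1) : (A - B) 0 0 = A 0 0 - B 0 0 by rewrite !mxE.
have Gs a : (a *: laplacian G)^T = a *: laplacian G by rewrite linearZ /= laplacian_sym.
clearbody L; split; split; try (by rewrite raddfB /= Gs Ls); move=> x.
- rewrite mulmxBr mulmxBl D1 qL -scalemxAr -scalemxAl [X in _ - X]mxE.
  have := key x; rewrite ler_norml => /andP[+ _].
  move: ((x^T *m (\sum_i _) *m x) 0 0) ((x^T *m laplacian G *m x) 0 0) => q' q h.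
  have -> : t%:R^-1 * q' - (1 - eps) * q = t%:R^-1 * (q' - t%:R * q + eps * t%:R * q).
    by field; rewrite gt_eqF.
  by rewrite mulr_ge0 ?invr_ge0 ?(ltW tR) //; lra.
- rewrite mulmxBr mulmxBl D1 qL -scalemxAr -scalemxAl [X in X - _]mxE.
  have := key x; rewrite ler_norml => /andP[_].
  move: ((x^T *m (\sum_i _) *m x) 0 0) ((x^T *m laplacian G *m x) 0 0) => q' q h.
  have -> : (1 + eps) * q - t%:R^-1 * q' = t%:R^-1 * (eps * t%:R * q - (q' - t%:R * q)).
    by field; rewrite gt_eqF.
  by rewrite mulr_ge0 ?invr_ge0 ?(ltW tR) //; lra.
Qed.

Theorem theorem1p3 (R : realType) (c : R) (hc : 0 < c) :
  exists C : R, 0 < C /\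
  forall (n : nat) (G : wgraph R n) (eps : R) (t : nat)
    (d : measure_display) (Omega : measurableType d)
    (P : probability Omega R) (T : 'I_t -> Omega -> {set edge G}),
  (2 <= n)%N ->
  graph_connected G ->
  0 < eps ->
  t%:Z = Num.ceil (C * eps ^- 2 * ln n%:R ^+ 2) ->
  (forall i, random_spanning_tree P (T i)) ->
  mutually_independent P T ->
  ((1 - n%:R `^ (- c))%:E <=
   P [set w | let L := t%:R^-1 *: (\sum_(i < t) tree_laplacian (T i w)) in
        loewner_le ((1 - eps) *: laplacian G) L /\
        loewner_le L ((1 + eps) *: laplacian G)])%E.
Proof.
(* This makes the exponent [- (c + 3) * ln n]; the 3 extra powers of [n] pay for the factor [4 * n]
   of the two tails. *)
have [s sE] : exists s : R, s = 384 * (c + 3) by eexists.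
have s384 : 384 <= s by rewrite sE; lra.
have s0 : 0 < s by lra.
exists (s ^+ 2); split; first exact: exprn_gt0.
move=> n G eps t d Omega P T n2 _ eps0 tE Ttree Tind.
have [l0 hl] := one_add_ln_le R n2; set l : R := ln n%:R in l0 hl tE.
have tge : s ^+ 2 * eps ^- 2 * l ^+ 2 <= t%:R.
  by have := ceil_ge (s ^+ 2 * eps ^- 2 * l ^+ 2); rewrite -tE.
have t0 : (0 < t)%N.
  rewrite -(ltr0n R); apply: lt_le_trans tge.
  by rewrite !mulr_gt0 ?invr_gt0 ?exprn_gt0.
have [|||||||theta [th0 th1 thE]] := @exponent_choice R (1 + l) l eps t%:R s => //.
- lra.
- by rewrite ler1n.
- have := ler_wpM2l (ltW (exprn_gt0 2 eps0)) tge; apply: le_trans.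
  by rewrite le_eqVlt; apply/orP; left; apply/eqP; field; rewrite gt_eqF.
have Tm i : finite_rv (T i) by have [] := Ttree i.
have Tlaw i S : P (T i @^-1` [set S]) = (tree_prob S)%:E by have [_] := Ttree i.
pose D (f : {ffun 'I_t -> {set edge G}}) :=
  `[< let L := t%:R^-1 *: (\sum_(i < t) tree_laplacian (f i)) in
        loewner_le ((1 - eps) *: laplacian G) L /\
        loewner_le L ((1 + eps) *: laplacian G) >].
have PD E := probability_tuple E Tm Tlaw Tind.
have -> : [set w | let L := t%:R^-1 *: (\sum_(i < t) tree_laplacian (T i w)) in
        loewner_le ((1 - eps) *: laplacian G) L /\
        loewner_le L ((1 + eps) *: laplacian G)] = [set w | D [ffun i => T i w]].
  have TE w : \sum_(i < t) tree_laplacian ([ffun i => T i w] i) =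
      \sum_(i < t) tree_laplacian (T i w) by apply: eq_bigr => i _; rewrite ffunE.
  by apply/seteqP; split=> w; rewrite /mkset /D TE => /asboolP.
rewrite PD lee_fin.
have total : \sum_(f : {ffun 'I_t -> {set edge G}}) \prod_i tree_prob (f i) = 1.
  apply: EFin_inj; rewrite -(PD xpredT).
  by rewrite -[RHS](probability_setT P); congr (P _); apply/seteqP; split.
(* A zero normaliser would make every [tree_prob] 0 by the division convention, contradicting total
   mass 1; [t0] supplies a factor. *)
have Z0 : up_mass (tree_weight (@weight _ _ G)) finset.set0 != 0.
  apply/eqP => Z0; move: total; rewrite big1.
    by move=> /esym/eqP; rewrite oner_eq0.
  move=> f _; rewrite (bigD1 (Ordinal t0)) //= tree_probE Z0 invr0.
  by rewrite mulr0 mul0r.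
have n0 : (0 < n)%N by exact: ltn_trans n2.
pose delta := theta * eps * t%:R.
have delta0 : 0 <= delta by rewrite !mulr_ge0 // ltW.
have tail (th : R) : `|th| = theta ->
    \sum_(f : {ffun 'I_t -> {set edge G}} | deviates th delta f)
      \prod_i tree_prob (f i) <= 2 * n%:R * expR (- ((c + 3) * l)).
  move=> thN; have := @tree_tuple_tail _ _ G n0 Z0 t th delta.
  rewrite thN => /(_ th1 delta0) /le_trans; apply.
  have -> : th ^+ 2 = theta ^+ 2 by rewrite -thN real_normK ?num_real.
  apply: (@le_trans _ _ (2 * n%:R * (expR (8 * theta ^+ 2 * (1 + l) * t%:R) *
      expR (- (delta / 2))))).
    rewrite mulrA ler_wpM2r ?expR_ge0 // -/l.
    have : 1 <= expR (8 * theta ^+ 2 * (1 + l) * t%:R).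
      by apply: le_trans (expR_ge1Dx _); rewrite lerDl !mulr_ge0 //; lra.
    have n1 : 1 <= n%:R :> R by rewrite ler1n.
    move: (expR _) => e e1; have : 1 * 1 <= n%:R * e by rewrite ler_pM.
    lra.
  rewrite -expRD ler_wpM2l ?mulr_ge0 // ler_expR.
  apply: le_trans thE _; rewrite sE; have -> : 384 * (c + 3) / 384 = c + 3 by field.
  by [].
have bad : \sum_(f | ~~ D f) \prod_i tree_prob (f i) <= n%:R `^ (- c).
  apply: (@le_trans _ _ (2 * n%:R * expR (- ((c + 3) * l)) +
      2 * n%:R * expR (- ((c + 3) * l)))).
    have tp := tail theta (gtr0_norm th0).
    have tn := tail (- theta) (etrans (normrN _) (gtr0_norm th0)).
    apply: le_trans (lerD tp tn).
    rewrite big_mkcond [X in _ <= X + _]big_mkcond [X in _ <= _ + X]big_mkcond -big_split /=.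
    apply: ler_sum => f _.
    have pf : 0 <= \prod_i tree_prob (f i) by apply: prodr_ge0 => i _; exact: tree_prob_ge0.
    have [_|nDf] := boolP (D f).
      by do 2 case: ifP => _; rewrite ?addr_ge0 ?addr0 ?add0r.
    suff : deviates theta delta f || deviates (- theta) delta f.
      by case: ifP; case: ifP => //=; rewrite ?addr0 ?add0r ?lerDl.
    apply: contraNT nDf; rewrite negb_or => /andP[up low]; apply/asboolP.
    exact: loewner_of_not_deviates t0 th0 up low.
  have nR : 0 < n%:R :> R by rewrite ltr0n.
  rewrite /powR (gt_eqF nR) -/l.
  (* After factoring out the exponential, [4 * n <= n ^+ 3] remains, true as [n >= 2]. *)
  have -> : - c * l = - ((c + 3) * l) + l * 3%:R by ring.
  rewrite expRD expRM_natr lnK ?posrE //.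
  rewrite -mulrDl mulrC ler_wpM2l ?expR_ge0 //.
  have : (2 : R) <= n%:R by rewrite ler_nat.
  move: (n%:R : R) => x x2; nra.
have := total; rewrite (bigID D) /=; lra.
Qed.
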